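(* Using Gaussian RBFs with shape parameter $\varepsilon=cN$, where $c=\frac{\pi}{2T\sqrt{2\log(1+\tau_0^{-2})}}$, the linear system $A-AZ^*A$ has approximately constant rank in the following sense. There exists a bounded matrix $Q$, with $\|Q\|_\infty\le 1$, such that for any small tolerance $\delta>0$ we have $$\operatorname{rank}(A-AZ^*A+\delta Q)\le 4W$$ with $$W=\frac{1}{\pi}\sqrt{-2\log\delta\,\log(1+\tau_0^{-2})}.$$
   Context: The setting is univariate non-periodic least squares approximation on $[-1,1]$ with periodized Gaussian radial basis functions (RBFs) on a larger interval $[-T,T]$, $T>1$. Let $N, s$ be positive integers and $L=sN$; $\tau_0>0$ is a (small) threshold that determines the shape parameter. The Gaussian RBF is $\phi(r)=e^{-\varepsilon^2r^2}$ and its periodization is $\phi^{\rm per}(x)=\sum_{m=-\infty}^{\infty}\phi(x-2mT)$. The centers are $c_j=-T+(j-1)\frac{2T}{N}$, $j=1,\dots,N$; the grid points are $\tilde x_i=-T+(i-1)\frac{2T}{L}$, $i=1,\dots,L$; the basis functions are $\phi_j(x)=\phi^{\rm per}(x-c_j)$. The matrix $A^{\rm c}\in\mathbb{R}^{L\times N}$ has entries $A^{\rm c}_{ij}=\phi_j(\tilde x_i)$. The permutation matrix $\Pi\in\mathbb{R}^{L\times L}$ reorders the rows so that $\Pi A^{\rm c}$ is the vertical stack of $N\times N$ circulant blocks $A^{\rm c}_1,\dots,A^{\rm c}_s$, where $A^{\rm c}_k$ consists of the rows $k+(j-1)s$, $j=1,\dots,N$, of $A^{\rm c}$. The collocation points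 are the grid points $\tilde x_i$ lying in $[-1,1]$; there are $M$ of them, ordered as in the permuted grid, and $s$ is large enough that $M>N$. The matrix $R\in\mathbb{R}^{M\times L}$ is the restriction operator selecting from the permuted rows those corresponding to the collocation points, so that $A=R\,\Pi A^{\rm c}\in\mathbb{R}^{M\times N}$ has entries $\phi_j(x_i)$ at the collocation points $x_i$, and $E=R^\dagger\in\mathbb{R}^{L\times M}$ is the corresponding extension by zero-padding. The unitary DFT matrix $F\in\mathbb{C}^{N\times N}$ is $F_{kl}=\frac{1}{\sqrt N}e^{2\pi\mathrm{i}(k-1)(l-1)/N}$, $P\in\mathbb{C}^{L\times L}$ is the block-diagonal matrix with $s$ copies of $F^*$ on its diagonal, $B=P\,\Pi A^{\rm c}F\in\mathbb{C}^{L\times N}$, $B^\dagger$ is the pseudo-inverse of $B$, and $Z^*=FB^\dagger PE$.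
   Formalization: Q may depend on δ (with norm ≤ 1 throughout), and ''small δ'' means below a threshold depending only on τ₀; a single Q for all such δ is impossible, since it would bound the exact rank of A−AZ*A independently of N, while that rank equals N when M>N and L−M>N. *)

(* Defs.v *)
From mathcomp Require Import all_boot all_order all_fingroup all_algebra.
From mathcomp Require Import spectral.
From mathcomp Require Import complex mxtens.
From mathcomp Require Import all_classical all_reals all_analysis.

Set Implicit Arguments.
Unset Strict Implicit.
Unset Printing Implicit Defensive.

Import Order.TTheory GRing.Theory Num.Theory.

Local Open Scope ring_scope.
Local Open Scope complex_scope.
Local Open Scope sesquilinear_scope.

Definition moore_penrose (C : numClosedFieldType) (m n : nat)
    (A : 'M[C]_(m, n)) (X : 'M[C]_(n, m)) : Prop :=
  [/\ A *m X *m A = A, X *m A *m X = X,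
      (A *m X)^t* = A *m X & (X *m A)^t* = X *m A].

Definition pinv (C : numClosedFieldType) (m n : nat) (A : 'M[C]_(m, n)) :
    'M[C]_(n, m) :=
  xget 0 [set X | moore_penrose A X]%classic.

Section PseudoInverse.
Variable C : numClosedFieldType.

Lemma trmxC_mul (m n p : nat) (A : 'M[C]_(m, n)) (B : 'M[C]_(n, p)) :
  (A *m B)^t* = B^t* *m A^t*.
Proof. by rewrite trmx_mul map_mxM. Qed.

Lemma mul_trmxC_eq0 (m n : nat) (A : 'M[C]_(m, n)) : A *m A^t* = 0 -> A = 0.
Proof.
move=> A0; apply/matrixP => i j; rewrite mxE.
have /matrixP/(_ i i) := A0; rewrite !mxE => /eqP.
rewrite psumr_eq0 => [/allP/(_ j)|k _]; last by rewrite !mxE mul_conjC_ge0.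
by rewrite mem_index_enum !mxE mul_conjC_eq0 => /(_ isT)/eqP.
Qed.

Lemma row_free_gram (m n : nat) (A : 'M[C]_(m, n)) :
  row_free A -> A *m A^t* \in unitmx.
Proof.
move=> Afree; rewrite -row_free_unit -kermx_eq0; apply/eqP.
set K := kermx _; have KA : K *m (A *m A^t*) = 0 by rewrite mulmx_ker.
apply: (row_free_inj Afree); rewrite mul0mx; apply: mul_trmxC_eq0.
by rewrite trmxC_mul mulmxA -(mulmxA K) KA mul0mx.
Qed.

Lemma moore_penrose_factor (m n r : nat) (K : 'M[C]_(m, r)) (D : 'M[C]_(r, n)) :
  K^t* *m K \in unitmx -> D *m D^t* \in unitmx ->
  moore_penrose (K *m D)
    (D^t* *m invmx (D *m D^t*) *m (invmx (K^t* *m K) *m K^t*)).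
Proof.
move=> uK uD.
have inv_herm (p : nat) (G : 'M[C]_p) : G^t* = G -> (invmx G)^t* = invmx G.
  by move=> GE; rewrite trmx_inv map_invmx GE.
have hK : (invmx (K^t* *m K))^t* = invmx (K^t* *m K).
  by apply: inv_herm; rewrite trmxC_mul trmxCK.
have hD : (invmx (D *m D^t*))^t* = invmx (D *m D^t*).
  by apply: inv_herm; rewrite trmxC_mul trmxCK.
have := mulmxV uD; have := mulVmx uK.
set Ki := invmx (K^t* *m K) in hK *; set Di := invmx (D *m D^t*) in hD *.
move=> KiK DDi; set X := _ *m _ *m (_ *m _).
have AX : K *m D *m X = K *m Ki *m K^t*.
  by rewrite /X !mulmxA -(mulmxA K D) -(mulmxA K (D *m _)) DDi mulmx1.
have XA : X *m (K *m D) = D^t* *m Di *m D.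
  by rewrite /X !mulmxA -(mulmxA _ (K^t*) K) -(mulmxA _ Ki) KiK mulmx1.
split.
- by rewrite AX mulmxA -(mulmxA _ (K^t*) K) -(mulmxA _ Ki) KiK mulmx1.
- by rewrite XA /X -!mulmxA (mulmxA D) (mulmxA (D *m _)) DDi mul1mx.
- by rewrite AX !trmxC_mul trmxCK hK mulmxA.
- by rewrite XA !trmxC_mul trmxCK hD mulmxA.
Qed.

Lemma moore_penrose_exists (m n : nat) (A : 'M[C]_(m, n)) :
  exists X, moore_penrose A X.
Proof.
rewrite -(mulmx_base A); eexists; apply: moore_penrose_factor; last first.
  exact/row_free_gram/row_base_free.
rewrite -{2}[col_base A]trmxCK; apply: row_free_gram.
by rewrite /row_free mxrank_map mxrank_tr; exact: col_base_full.
Qed.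

Lemma moore_penrose_uniq (m n : nat) (A : 'M[C]_(m, n)) (X Y : 'M[C]_(n, m)) :
  moore_penrose A X -> moore_penrose A Y -> X = Y.
Proof.
case=> AXA XAX hAX hXA [AYA YAY hAY hYA].
have AXY : A *m X = A *m Y.
  by rewrite -[LHS]hAX -{1}AYA -(mulmxA (A *m Y)) trmxC_mul hAX hAY mulmxA AXA.
have XYA : X *m A = Y *m A.
  rewrite -[LHS]hXA -{1}AYA -mulmxA mulmxA trmxC_mul hXA hYA.
  by rewrite -!mulmxA (mulmxA A) AXA.
by rewrite -XAX XYA -mulmxA AXY mulmxA YAY.
Qed.

Lemma pinvP (m n : nat) (A : 'M[C]_(m, n)) : moore_penrose A (pinv A).
Proof.
rewrite /pinv; case: xgetP => [X _ //|noX].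
by have [X AX] := moore_penrose_exists A; case: (noX X).
Qed.

Lemma pinv_unique (m n : nat) (A : 'M[C]_(m, n)) (X : 'M[C]_(n, m)) :
  moore_penrose A X -> pinv A = X.
Proof. exact/moore_penrose_uniq/pinvP. Qed.

End PseudoInverse.

(* The matrix norm induced by the vector maximum norm. *)
Definition norm_inf (R : realType) (m n : nat) (A : 'M[R[i]]_(m, n)) : R :=
  \big[Num.max/0]_(i < m) \sum_(j < n) ComplexField.Normc.normc (A i j).

Section PeriodizedGaussians.
Variable R : realType.

Definition gauss (eps r : R) : R := expR (- (eps ^+ 2 * r ^+ 2)).

(* All terms are nonnegative, so that the sum over the integers is an
   unconditional sum in the extended reals; it is finite when eps and T are
   positive. *)
Definition gauss_per (eps T x : R) : R :=
  fine (\esum_(m in [set: int]) (gauss eps (x - 2 * m%:~R * T))%:E).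

Definition shape (T tau0 : R) (N : nat) : R :=
  pi / (2 * T * Num.sqrt (2 * ln (1 + tau0 ^- 2))) * N%:R.

(* Indices start at 0: the center usually written c_(j+1) is [center T j]. *)
Definition center (T : R) (N : nat) (j : 'I_N) : R :=
  - T + j%:R * (2 * T / N%:R).

Definition grid (T : R) (L : nat) (i : 'I_L) : R :=
  - T + i%:R * (2 * T / L%:R).

Variables (T tau0 : R) (N s : nat).

Definition basis (j : 'I_N) (x : R) : R :=
  gauss_per (shape T tau0 N) T (x - center T j).

Definition Ac : 'M[R]_(s * N, N) := \matrix_(i, j) basis j (grid T i).

(* Permuted row k * N + j, i.e. row j of the k-th N x N block, is row k + j * s
   of [Ac]. *)
Lemma reorder_subproof (r : 'I_(s * N)) : (r %/ N + r %% N * s < s * N)%N.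
Proof.
have /= := ltn_ord (mxtens_unindex r).1; have /= := ltn_ord (mxtens_unindex r).2.
move=> rN rs; apply: (@leq_trans (s + r %% N * s)%N); first by rewrite ltn_add2r.
by rewrite -mulSn mulnC leq_mul2l rN orbT.
Qed.

Definition reorder (r : 'I_(s * N)) : 'I_(s * N) := Ordinal (reorder_subproof r).

Lemma reorder_inj : injective reorder.
Proof.
move=> r t /(congr1 val) /= rt.
have rs : (r %/ N < s)%N := ltn_ord (mxtens_unindex r).1.
have ts : (t %/ N < s)%N := ltn_ord (mxtens_unindex t).1.
have s_gt0 : (0 < s)%N by apply: leq_ltn_trans rs.
have qE : (r %/ N = t %/ N)%N.
  by have := congr1 (modn^~ s) rt; rewrite ![(_ + _ * s)%N]addnC !modnMDl !modn_small.
have mE : (r %% N = t %% N)%N.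
  by move: rt; rewrite qE => /addnI/eqP; rewrite eqn_pmul2r // => /eqP.
by apply: val_inj; rewrite /= (divn_eq r N) (divn_eq t N) qE mE.
Qed.

Definition Pimx : 'M[R]_(s * N) := perm_mx (perm reorder_inj).

(* The positions, in the permuted order, of the grid points in [-1, 1]. *)
Definition colloc : {set 'I_(s * N)} :=
  [set r | -1 <= grid T (reorder r) <= 1].

Definition npts : nat := #|colloc|.

(* [enum_val] lists the elements of [colloc] in increasing order. *)
Definition restr : 'M[R]_(npts, s * N) :=
  \matrix_(p, r) (r == enum_val p)%:R.

Definition ext : 'M[R]_(s * N, npts) := restr^T.

Definition Amx : 'M[R]_(npts, N) := restr *m (Pimx *m Ac).

Lemma AmxE (p : 'I_npts) (j : 'I_N) :
  Amx p j = basis j (grid T (reorder (enum_val p))).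
Proof.
rewrite /Amx -row_permE mxE (bigD1 (enum_val p)) //= big1 => [|r /negPf rp].
  by rewrite !mxE eqxx mul1r addr0 permE.
by rewrite !mxE rp mul0r.
Qed.

Definition toC (m n : nat) (X : 'M[R]_(m, n)) : 'M[R[i]]_(m, n) :=
  map_mx (real_complex R) X.

Lemma extE : toC ext = pinv (toC restr).
Proof.
have RE : restr *m ext = 1%:M.
  apply/matrixP => p q; rewrite !mxE (bigD1 (enum_val p)) //= big1.
    by rewrite !mxE eqxx mul1r addr0 (inj_eq enum_val_inj).
  by move=> r /negPf rp; rewrite !mxE rp mul0r.
have toCM (m n k : nat) (X : 'M[R]_(m, n)) (Y : 'M[R]_(n, k)) :
    toC X *m toC Y = toC (X *m Y) by rewrite /toC map_mxM.
have toCt (m n : nat) (X : 'M[R]_(m, n)) : (toC X)^t* = toC X^T.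
  by apply/matrixP => i j; rewrite !mxE; exact: conjc_real.
apply/esym/pinv_unique; split.
- by rewrite -mulmxA !toCM mulmxA RE mul1mx.
- by rewrite -mulmxA !toCM RE mulmx1.
- by rewrite toCM RE toCt trmx1.
- by rewrite toCM toCt trmx_mul trmxK.
Qed.

Definition dft : 'M[R[i]]_N :=
  \matrix_(k, l)
    (((Num.sqrt N%:R)^-1)%:C *
     (let t := 2 * pi * (k * l)%N%:R / N%:R : R in cos t +i* sin t)).

(* The Kronecker product 1 (x) F^* is block diagonal with s blocks F^*. *)
Definition Pmx : 'M[R[i]]_(s * N) := (1%:M : 'M[R[i]]_s) *t dft^t*.

Definition Bmx : 'M[R[i]]_(s * N, N) := Pmx *m toC (Pimx *m Ac) *m dft.

Definition Zstar : 'M[R[i]]_(N, npts) := dft *m pinv Bmx *m Pmx *m toC ext.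

Definition AZres : 'M[R[i]]_(npts, N) := toC Amx - toC Amx *m Zstar *m toC Amx.

End PeriodizedGaussians.

Definition halfwidth (R : realType) (tau0 delta : R) : R :=
  pi^-1 * Num.sqrt (- 2 * ln delta * ln (1 + tau0 ^- 2)).

(* Main.v *)
(** Let h = 2T/N be the distance between centers. In units of h the basis
functions are translates of exp (- al u^2) with al = a^2 depending on tau0 only,
and delta = exp (- al W^2). With Phi = Pi A^c, Omega the set of collocation rows
and Gam the Gram matrix of the parts of the columns of Phi outside Omega,
A - A Z^* A is the restriction to Omega of X = Phi (Phi^T Phi)^-1 Gam.

A column of X whose center lies at distance t from the boundary of [-1, 1] has
size exp (- al t^2), inside as well as outside. Keeping the columns with t <= W
on both sides of both endpoints would thus give about 4W columns, but with
rounding and constants this is slightly too many. There is slack inside: a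
column j at depth t >= t0 = 4W/5 is approximated by a combination X C_j of the
other columns, C_j being the ridge regression of j on all columns J that are not
at depth t0 or more, with parameter lam = s exp (- al W^2). The residual
w = Gam (1 - C)_j is lam C_j on J, and is bounded by sqrt (Gam_ll Gam_jj) by
Cauchy-Schwarz off J, so that in both cases it gains about exp (- al W^2 / 2) over
sqrt Gam_jj; and C_j is so small that the columns of J at distance more than
r0 = 11W/10 outside [-1, 1] may be dropped from the combination. This leaves
2 (t0 + r0 + 1) <= 4W columns when W >= 10.

The constants depend on tau0 only because Phi^T Phi >= c s with c independent of
T, N and s: by the q-binomial theorem the convolution with a Gaussian of offset
x in [0, 1/4] is up to a small error a product of operators 1 + b S with S a
shift, and |(1 + b S) z| >= |1 - b| |z|. *)

Require Import Defs.
From mathcomp Require Import all_boot all_order all_fingroup all_algebra.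
From mathcomp Require Import complex mxtens spectral.
From mathcomp Require Import all_classical all_reals all_analysis.
From mathcomp Require Import ring lra zify.
Set Implicit Arguments.
Unset Strict Implicit.
Unset Printing Implicit Defensive.

Import Order.TTheory GRing.Theory Num.Theory.

Local Open Scope ring_scope.

(** * Unconditional sums *)

Section UnconditionalSums.
Variables (R : realType) (T : choiceType) (f : T -> R).
Hypothesis f_ge0 : forall x, 0 <= f x.

Lemma esum_le_bound (B : R) :
  (forall s : seq T, uniq s -> \sum_(x <- s) f x <= B) ->
  (\esum_(x in [set: T]) (f x)%:E <= B%:E)%E.
Proof.
move=> fB; apply: ge_ereal_sup => _ [A [finA _] <-].
by rewrite fsbig_finite//= sumEFin lee_fin fB// fset_uniq.
Qed.

Lemma esum_fin_num (B : R) :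
  (forall s : seq T, uniq s -> \sum_(x <- s) f x <= B) ->
  \esum_(x in [set: T]) (f x)%:E \is a fin_num.
Proof.
move=> fB; rewrite ge0_fin_numE; last by apply: esum_ge0 => x _; rewrite lee_fin.
by apply: le_lt_trans (esum_le_bound fB) _; rewrite ltry.
Qed.

Lemma fine_esum_le (B : R) :
  (forall s : seq T, uniq s -> \sum_(x <- s) f x <= B) ->
  fine (\esum_(x in [set: T]) (f x)%:E) <= B.
Proof.
by move=> fB; rewrite -lee_fin fineK ?(esum_fin_num fB)//; exact: esum_le_bound.
Qed.

Lemma fine_esum_ge (B : R) (s : seq T) :
  (forall s : seq T, uniq s -> \sum_(x <- s) f x <= B) -> uniq s ->
  \sum_(x <- s) f x <= fine (\esum_(x in [set: T]) (f x)%:E).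
Proof.
move=> fB us; rewrite -lee_fin fineK ?(esum_fin_num fB)//.
apply: esum_ge; exists [set` s]%classic; first by split=> //; exact: finite_seq.
by rewrite -fsbig_seq// sumEFin.
Qed.

End UnconditionalSums.

Lemma ler_sum_subseq (R : numDomainType) (I : eqType) (s t : seq I) (F : I -> R) :
  (forall i, 0 <= F i) -> uniq s -> uniq t -> {subset s <= t} ->
  \sum_(i <- s) F i <= \sum_(i <- t) F i.
Proof.
move=> F0 us ut st; rewrite [leRHS](bigID [in s])/= -[X in _ <= X + _]big_filter.
rewrite [X in _ <= X + _](perm_big s)/=; first by rewrite lerDl sumr_ge0.
apply: uniq_perm; rewrite ?filter_uniq// => i.
by rewrite mem_filter andb_idr//; exact: st.
Qed.

Lemma sum_geo_nat (R : realType) (r : R) (s : seq nat) :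
  0 <= r < 1 -> uniq s -> \sum_(k <- s) r ^+ k <= (1 - r)^-1.
Proof.
move=> /andP[r0 r1] us; pose m := (\max_(k <- s) k).+1.
have sm : {subset s <= iota 0 m}.
  by move=> k ks; rewrite mem_iota/= add0n ltnS; exact: leq_bigmax_seq.
apply: (@le_trans _ _ (\sum_(k <- iota 0 m) r ^+ k)).
  by apply: ler_sum_subseq => //; [move=> i; rewrite exprn_ge0|exact: iota_uniq].
have -> : iota 0 m = index_iota 0 m by rewrite /index_iota subn0.
rewrite big_mkord -[leRHS]mul1r ler_pdivlMr ?subr_gt0//.
have -> : (\sum_(i < m) r ^+ i) * (1 - r) = 1 - r ^+ m.
  by rewrite -[RHS]opprB subrX1 -mulNr opprB mulrC.
by rewrite gerBl exprn_ge0.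
Qed.

Lemma sum_geo_int (R : realType) (r : R) (s : seq int) :
  0 <= r < 1 -> uniq s -> \sum_(k <- s) r ^+ `|k|%N <= 2 / (1 - r).
Proof.
move=> r01 us; rewrite (bigID (fun k : int => 0 <= k))/= mulr_natl mulr2n.
apply: lerD; rewrite -big_filter.
- rewrite -(big_map absz xpredT (fun k => r ^+ k)); apply: sum_geo_nat => //.
  rewrite map_inj_in_uniq ?filter_uniq// => x y; rewrite !mem_filter; lia.
- rewrite -(big_map absz xpredT (fun k => r ^+ k)); apply: sum_geo_nat => //.
  rewrite map_inj_in_uniq ?filter_uniq// => x y; rewrite !mem_filter; lia.
Qed.

(** A bound on the sum of exp (- b (n - y)^2) over the integers n that is uniform in y, see
    [gauss_int_sum]. *)
Definition gbound (R : realType) (b : R) : R := expR b * (2 / (1 - expR (- b))).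

(** With k = n - floor y and f the fractional part of y, |k| <= 1 + (k - f)^2. Each term is thus at
    most exp b times the |k|-th power of exp (- b), and a two-sided geometric series remains. *)
Lemma gauss_int_sum (R : realType) (b y : R) (s : seq int) : 0 < b -> uniq s ->
  \sum_(n <- s) expR (- (b * (n%:~R - y) ^+ 2)) <= gbound b.
Proof.
move=> b0 us; pose k (n : int) := n - Num.floor y.
apply: (@le_trans _ _ (\sum_(n <- s) expR b * expR (- b) ^+ `|k n|%N)).
  apply: ler_sum => n _; rewrite -expRM_natr -expRD ler_expR.
  have := floor_le_tmp y; have := floorD1_gt y.
  rewrite intrD/= => hlt hle.
  have kE : (k n)%:~R = n%:~R - (Num.floor y)%:~R :> R by rewrite intrB.
  have -> : n%:~R - y = (k n)%:~R - (y - (Num.floor y)%:~R) by rewrite kE; ring.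
  have : 0 <= y - (Num.floor y)%:~R <= 1 by apply/andP; split; lra.
  clear kE; move: (y - _) (k n) => f {}k /andP[f0 f1].
  have -> : `|k|%N%:R = `|k%:~R| :> R by rewrite -intr_norm; case: k.
  suff : `|k%:~R| <= 1 + (k%:~R - f) ^+ 2 by move=> h; nra.
  have kk (m : nat) : m%:R <= m%:R ^+ 2 :> R.
    by rewrite -natrX ler_nat; case: m => // m; rewrite leq_pmulr.
  case: k => [[|k]|k].
  - by rewrite normr0; nra.
  - rewrite -pmulrn ger0_norm ?ler0n// -natr1.
    by have := ler0n R k; have := kk k; set x := _%:R => *; nra.
  rewrite NegzE mulrNz -pmulrn normrN ger0_norm ?ler0n// -natr1.
  by have := ler0n R k; set x := _%:R => x0; nra.
rewrite -mulr_sumr ler_pM2l ?expR_gt0// -(big_map k xpredT (fun i => expR (- b) ^+ `|i|%N)).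
apply: sum_geo_int; first by rewrite expR_ge0 expR_lt1 oppr_lt0.
by rewrite map_inj_uniq// => m n /addIr.
Qed.

(** * The periodized Gaussian in units of the distance between centers *)

(* [gauss_per] in units of the distance 2T/N between centers, so that the period
   is N: see [gauss_per_gper]. *)
Definition gper (R : realType) (al : R) (N : nat) (u : R) : R :=
  fine (\esum_(m in [set: int]) (expR (- (al * (u - m%:~R * N%:R) ^+ 2)))%:E).

(** The square of [shape] times the distance 2T/N between centers; T and N cancel because the shape
    parameter is proportional to N/T. *)
Definition alpha (R : realType) (tau0 : R) : R := pi ^+ 2 / (2 * ln (1 + tau0 ^- 2)).

Lemma ln1V_gt0 (R : realType) (tau0 : R) : 0 < tau0 -> 0 < ln (1 + tau0 ^- 2).
Proof. by move=> t0; rewrite ln_gt0// ltrDl invr_gt0 exprn_gt0. Qed.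

Lemma alpha_gt0 (R : realType) (tau0 : R) : 0 < tau0 -> 0 < alpha tau0.
Proof.
by move=> t0; rewrite divr_gt0 ?exprn_gt0 ?pi_gt0// mulr_gt0 ?ln1V_gt0.
Qed.

Lemma gauss_per_gper (R : realType) (T tau0 : R) (N : nat) (u : R) :
  0 < T -> 0 < tau0 -> (0 < N)%N ->
  gauss_per (Defs.shape T tau0 N) T (2 * T / N%:R * u) = gper (alpha tau0) N u.
Proof.
move=> T0 t0 N0; congr fine; apply: eq_esum => m _; congr (expR (- _))%:E.
have N0' : N%:R != 0 :> R by rewrite pnatr_eq0 -lt0n.
have l0 := ln1V_gt0 t0.
have sq : Num.sqrt (2 * ln (1 + tau0 ^- 2)) ^+ 2 = 2 * ln (1 + tau0 ^- 2).
  by rewrite sqr_sqrtr// mulr_ge0// ltW.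
have s0 : Num.sqrt (2 * ln (1 + tau0 ^- 2)) != 0.
  by rewrite gt_eqF// sqrtr_gt0 mulr_gt0.
rewrite /Defs.shape /alpha; set S := Num.sqrt _ in sq s0 *; rewrite -sq; field.
by rewrite s0 N0' gt_eqF.
Qed.

Section PeriodizedGaussian.
Variables (R : realType) (al : R) (N : nat).
Hypotheses (al_gt0 : 0 < al) (N_gt0 : (0 < N)%N).

(** The points m N are distinct integers. The bound makes the unconditional sum in [gper] finite, so
    that [fine] returns its true value. *)
Lemma gper_terms_le (u : R) (s : seq int) : uniq s ->
  \sum_(m <- s) expR (- (al * (u - m%:~R * N%:R) ^+ 2)) <= gbound al.
Proof.
move=> us; rewrite (eq_bigr (fun m : int =>
    expR (- (al * ((m * N%:Z)%:~R - u) ^+ 2)))); last first.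
  by move=> m _; rewrite -sqrrN opprB intrM.
rewrite -(big_map (fun m => m * N%:Z) xpredT
  (fun n : int => expR (- (al * (n%:~R - u) ^+ 2)))).
apply: gauss_int_sum => //; rewrite map_inj_uniq// => m n; nia.
Qed.

Lemma gper_ge_sum (u : R) (s : seq int) : uniq s ->
  \sum_(m <- s) expR (- (al * (u - m%:~R * N%:R) ^+ 2)) <= gper al N u.
Proof.
move=> us; exact: (fine_esum_ge _ (gper_terms_le u)).
Qed.

Lemma gper_ge0 u : 0 <= gper al N u.
Proof. by have := @gper_ge_sum u [::]; rewrite big_nil; exact. Qed.

(** The k i have distinct residues, so the integers k i - m N are distinct over all pairs (i, m),
    and the sum of periodizations unfolds into one Gaussian sum over distinct integers. *)
Lemma sum_gper_le (x B : R) (k : 'I_N -> int) :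
  (forall i j, (k i = k j %[mod N])%Z -> i = j) ->
  (forall s : seq int, uniq s ->
     \sum_(n <- s) expR (- (al * (x + n%:~R) ^+ 2)) <= B) ->
  \sum_i gper al N (x + (k i)%:~R) <= B.
Proof.
move=> k_inj sB; rewrite /gper.
pose F i m := expR (- (al * (x + (k i)%:~R - m%:~R * N%:R) ^+ 2)).
have FB s : uniq s -> \sum_(m <- s) \sum_i F i m <= B.
  move=> us; rewrite (eq_bigr (fun m : int => \sum_(i <- index_enum 'I_N)
      expR (- (al * (x + (k i - m * N%:Z)%:~R) ^+ 2)))); last first.
    by move=> m _; apply: eq_bigr => i _; rewrite /F intrB intrM addrA.
  rewrite -(big_allpairs_dep (h := fun (m : int) i => k i - m * N%:Z)
    (F := fun n : int => expR (- (al * (x + n%:~R) ^+ 2)))); apply: sB.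
  rewrite allpairs_uniq ?index_enum_uniq// => -[m i] [n j] _ _ /= e.
  have ij : i = j.
    apply: k_inj; apply/eqP; rewrite eqz_mod_dvd; apply/dvdzP.
    by exists (m - n); rewrite mulrBl; lia.
  by move: e; rewrite ij => /addrI/oppr_inj e; congr pair; nia.
have -> : \sum_i fine (\esum_(m in [set: int]) (F i m)%:E) =
    fine (\esum_(m in [set: int]) (\sum_i F i m)%:E).
  rewrite sum_fine; last first.
    move=> i _; apply: esum_fin_num (gper_terms_le (x + (k i)%:~R)).
    by move=> m; exact: expR_ge0.
  rewrite -esum_sum//; last by move=> *; rewrite lee_fin expR_ge0.
  by congr fine; apply: eq_esum => m _; rewrite sumEFin.
by apply: fine_esum_le => // m; apply: sumr_ge0 => i _; exact: expR_ge0.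
Qed.

Lemma sum_gper_bound (x : R) (k : 'I_N -> int) :
  (forall i j, (k i = k j %[mod N])%Z -> i = j) ->
  \sum_i gper al N (x + (k i)%:~R) <= gbound al.
Proof.
move=> kinj; apply: sum_gper_le => // s us.
have := gauss_int_sum (- x) al_gt0 us; under eq_bigr do rewrite opprK addrC.
exact.
Qed.

End PeriodizedGaussian.

(** The exponent al is split into (1 - c) al, estimated at distance t, and c al, which keeps the sum
    over the periods under control. *)
Lemma gper_decay (R : realType) (al : R) (N : nat) (u t c : R) :
  0 < al -> (0 < N)%N -> 0 <= t -> 0 < c < 1 ->
  (forall m : int, t <= `|u - m%:~R * N%:R|) ->
  gper al N u <= expR (- ((1 - c) * al * t ^+ 2)) * gper (c * al) N u.
Proof.
move=> al0 N0 t0 /andP[c0 c1] ut; apply: fine_esum_le => [m|s us]; first exact: expR_ge0.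
apply: le_trans (_ : expR (- ((1 - c) * al * t ^+ 2)) *
  (\sum_(m <- s) expR (- (c * al * (u - m%:~R * N%:R) ^+ 2))) <= _).
  rewrite mulr_sumr; apply: ler_sum => m _; rewrite -expRD ler_expR.
  have : t ^+ 2 <= (u - m%:~R * N%:R) ^+ 2.
    by rewrite -[leRHS]real_normK ?num_real// ler_pXn2r ?nnegrE.
  move: (_ - _) => v tv; have : 0 <= (1 - c) * al * (v ^+ 2 - t ^+ 2).
    by rewrite mulr_ge0 ?subr_ge0// mulr_ge0 ?subr_ge0 ?ltW//.
  lra.
by rewrite ler_pM2l ?expR_gt0// gper_ge_sum// mulr_gt0.
Qed.

(** * A lower Riesz bound from the q-binomial theorem *)

Section QBinomial.
Variables (R : realType) (p : R).
Hypothesis p01 : 0 < p < 1.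

(** The q-Pochhammer symbol (p; p)_k, which is the q-factorial times (1 - p)^k; these powers cancel
    in [qbin]. *)
Definition qfact (k : nat) : R := \prod_(i < k) (1 - p ^+ i.+1).

Definition qbin (r k : nat) : R :=
  if (k <= r)%N then qfact r / (qfact k * qfact (r - k)) else 0.

Let p_ge0 : 0 <= p. Proof. by case/andP: p01 => /ltW. Qed.
Let p_le1 : p <= 1. Proof. by case/andP: p01 => _ /ltW. Qed.

Let pS_lt1 i : p ^+ i.+1 < 1.
Proof. by rewrite exprn_ilt1//; case/andP: p01. Qed.

Lemma qfactS k : qfact k.+1 = qfact k * (1 - p ^+ k.+1).
Proof. by rewrite /qfact big_ord_recr. Qed.

Lemma qfact0 : qfact 0 = 1.
Proof. by rewrite /qfact big_ord0. Qed.

Lemma qfact_gt0 k : 0 < qfact k.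
Proof. by apply: prodr_gt0 => i _; rewrite subr_gt0. Qed.

Lemma qfact_le1 k : qfact k <= 1.
Proof.
apply: prodr_ile1 => i _.
by rewrite subr_ge0 ltW//= gerBl exprn_ge0.
Qed.

Lemma qfact_add m n : qfact (m + n) = qfact m * \prod_(i < n) (1 - p ^+ (m + i).+1).
Proof.
elim: n => [|n IH]; first by rewrite addn0 big_ord0 mulr1.
by rewrite addnS qfactS IH big_ord_recr/= mulrA.
Qed.

Lemma qbinn0 r : qbin r 0 = 1.
Proof. by rewrite /qbin qfact0 subn0 mul1r divff// gt_eqF ?qfact_gt0. Qed.

Lemma qpascal r k : (k <= r)%N ->
  qbin r.+1 k.+1 = qbin r k.+1 + p ^+ (r - k) * qbin r k.
Proof.
rewrite /qbin => kr; rewrite ltnS kr subSS.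
have f0 i : qfact i != 0 by rewrite gt_eqF ?qfact_gt0.
have g0 i : 1 - p ^+ i.+1 != 0 by rewrite gt_eqF ?subr_gt0.
case: ltnP => [kr'|rk].
  have -> : (r - k = (r - k.+1).+1)%N by lia.
  have [d ->] : exists d, (r = k + d.+1)%N by exists (r - k.+1)%N; lia.
  have -> : (k + d.+1 - k.+1 = d)%N by lia.
  rewrite !qfactS.
  have -> : p ^+ (k + d.+1).+1 = p ^+ d.+1 * p ^+ k.+1 by rewrite -exprD; congr (_ ^+ _); lia.
  by field; rewrite ?f0 ?g0.
have -> : r = k by lia.
by rewrite subnn qfact0 !mulr1 !divff// expr0 mul1r add0r.
Qed.

Definition qcoef (w : R) (r k : nat) : R := qbin r k * p ^+ 'C(k, 2) * w ^+ k.

Lemma qcoefS (w : R) (r k : nat) : (k <= r)%N ->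
  qcoef w r.+1 k.+1 = qcoef w r k.+1 + w * p ^+ r * qcoef w r k.
Proof.
move=> kr; rewrite /qcoef qpascal// binS bin1 exprS.
have -> : p ^+ r = p ^+ (r - k) * p ^+ k by rewrite -exprD subnK.
rewrite exprD; ring.
Qed.

(* Cauchy's q-binomial theorem: the product of the operators 1 + w p^m S, with
   S the shift, is the sum of [qcoef w r k] S^k. *)
Lemma qbinomial_step (w : R) (Z : int -> R) (r : nat) (n : int) :
  \sum_(k < r.+2) qcoef w r.+1 k * Z (n - k%:Z) =
  \sum_(k < r.+1) qcoef w r k * Z (n - k%:Z) +
  w * p ^+ r * \sum_(k < r.+1) qcoef w r k * Z (n - 1 - k%:Z).
Proof.
have -> : \sum_(k < r.+1) qcoef w r k * Z (n - k%:Z) =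
    \sum_(k < r.+2) qcoef w r k * Z (n - k%:Z).
  by rewrite [RHS]big_ord_recr/= {3}/qcoef /qbin ltnn !mul0r addr0.
rewrite [in LHS]big_ord_recl [in RHS]big_ord_recl -addrA.
congr (_ + _); first by rewrite /qcoef !qbinn0.
rewrite mulr_sumr -big_split/=; apply: eq_bigr => k _.
rewrite /bump/= add1n qcoefS//; last by rewrite -ltnS.
have -> : n - k.+1%:Z = n - 1 - k%:Z by lia.
ring.
Qed.

End QBinomial.

(** * Products of operators 1 + b S on periodic sequences *)

Section PeriodicSequences.
Variables (R : realType) (N : nat).
Implicit Types Z : int -> R.

Definition periodic Z := forall n, Z (n - N%:Z) = Z n.

Definition pnormsq Z : R := \sum_(i < N) Z i%:Z ^+ 2.

Lemma pnormsq_shift Z : periodic Z -> pnormsq (fun n => Z (n - 1)) = pnormsq Z.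
Proof.
rewrite /periodic /pnormsq; case: N => [|m] ZN; first by rewrite !big_ord0.
rewrite [LHS]big_ord_recl [RHS]big_ord_recr/= [RHS]addrC.
congr (_ ^+ 2 + _); last first.
  by apply: eq_bigr => i _; congr (Z _ ^+ 2); rewrite /bump/=; lia.
by rewrite -(ZN m%:Z); congr Z => /=; lia.
Qed.

(** |Z + b SZ|^2 = b |Z + SZ|^2 + (1 - b) |Z|^2 + (b^2 - b) |SZ|^2. The first term is nonnegative,
    and since |SZ| = |Z| by periodicity the other two add up to (1 - b)^2 |Z|^2. *)
Lemma pnormsq_step Z (b : R) : 0 <= b -> periodic Z ->
  (1 - b) ^+ 2 * pnormsq Z <= pnormsq (fun n => Z n + b * Z (n - 1)).
Proof.
move=> b0 pZ.
have -> : pnormsq (fun n => Z n + b * Z (n - 1)) =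
    b * pnormsq (fun n => Z n + Z (n - 1)) + (1 - b) * pnormsq Z
    + (b ^+ 2 - b) * pnormsq (fun n => Z (n - 1)).
  by rewrite /pnormsq !mulr_sumr -!big_split/=; apply: eq_bigr => i _; ring.
rewrite pnormsq_shift//.
have : 0 <= b * pnormsq (fun n => Z n + Z (n - 1)).
  by rewrite mulr_ge0// sumr_ge0// => i _; rewrite sqr_ge0.
lra.
Qed.

Lemma pnormsq_qbinomial (p w : R) Z (r : nat) : 0 < p < 1 -> 0 <= w -> periodic Z ->
  \prod_(m < r) (1 - w * p ^+ m) ^+ 2 * pnormsq Z <=
  pnormsq (fun n => \sum_(k < r.+1) qcoef p w r k * Z (n - k%:Z)).
Proof.
move=> p01 w0 pZ.
have p0 : 0 <= p by case/andP: p01 => /ltW.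
elim: r => [|r IH].
  rewrite big_ord0 mul1r le_eqVlt; apply/orP; left; apply/eqP/eq_bigr => i _.
  by rewrite big_ord1 /qcoef qbinn0// expr0 !mulr1 mul1r subr0.
rewrite big_ord_recr/= mulrAC mulrC.
pose Y n := \sum_(k < r.+1) qcoef p w r k * Z (n - k%:Z).
have -> : pnormsq (fun n => \sum_(k < r.+2) qcoef p w r.+1 k * Z (n - k%:Z)) =
    pnormsq (fun n => Y n + w * p ^+ r * Y (n - 1)).
  by apply: eq_bigr => i _; rewrite qbinomial_step.
apply: le_trans (pnormsq_step _ _); last 2 first.
- by rewrite mulr_ge0// exprn_ge0.
- move=> n; apply: eq_bigr => k _; congr (_ * _).
  by rewrite -[in RHS]pZ; congr Z; lia.
by rewrite ler_wpM2l ?sqr_ge0.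
Qed.

End PeriodicSequences.

(** For 0 <= t <= 1, 1 - c t >= exp (- c t / (1 - c)), because 1 / (1 - c t) <= 1 + c t / (1 - c).
    The exponents form a geometric series, so the bound is uniform in M. *)
Lemma prod_geo_ge (R : realType) (c p : R) (M : nat) : 0 <= c < 1 -> 0 <= p < 1 ->
  expR (- (c / (1 - c) / (1 - p))) <= \prod_(l < M) (1 - c * p ^+ l).
Proof.
move=> /andP[c0 c1] /andP[p0 p1].
have c1' : 0 < 1 - c by rewrite subr_gt0.
apply: (@le_trans _ _ (\prod_(l < M) expR (- (c / (1 - c) * p ^+ l)))); last first.
  apply: ler_prod => l _; rewrite expR_ge0/=.
  have pl : 0 <= p ^+ l <= 1 by rewrite exprn_ge0// exprn_ile1// ltW.
  move: (p ^+ l) pl => t /andP[t0 t1].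
  have ct : 0 < 1 - c * t by nra.
  rewrite expRN -lef_pV2 ?posrE ?invr_gt0 ?expR_gt0// invrK.
  apply: le_trans (expR_ge1Dx _).
  rewrite -[leLHS]mul1r ler_pdivrMr// -subr_ge0.
  have -> : (1 + c / (1 - c) * t) * (1 - c * t) - 1 = c ^+ 2 * t * (1 - t) / (1 - c).
    by field; rewrite gt_eqF.
  by rewrite mulr_ge0 ?invr_ge0 ?(ltW c1')// !mulr_ge0// ?sqr_ge0// subr_ge0.
rewrite -expR_sum ler_expR sumrN lerN2 -mulr_sumr ler_wpM2l//.
  by rewrite divr_ge0// ltW.
rewrite -(big_mkord xpredT) /= sum_geo_nat ?iota_uniq// ?p0//.
Qed.

(** * Central q-binomial coefficients *)

Section CentralRatio.
Variables (R : realType) (p : R).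
Hypothesis p01 : 0 < p < 1.

Let p_ge0 : 0 <= p. Proof. by case/andP: p01 => /ltW. Qed.
Let p_le1 : p <= 1. Proof. by case/andP: p01 => _ /ltW. Qed.
Let pS_lt1 i : p ^+ i.+1 < 1.
Proof. by rewrite exprn_ilt1//; case/andP: p01. Qed.
Let qf0 i : qfact p i != 0. Proof. by rewrite gt_eqF ?qfact_gt0. Qed.

(** Normalized by the central coefficient, the q-binomial coefficients at M + n tend to 1 as M grows
    with n fixed; in the limit they drop out of the convolution. *)
Definition qratio (M k : nat) : R := qbin p (2 * M) k / qbin p (2 * M) M.

Lemma qbin_mid M : qbin p (2 * M) M = qfact p (2 * M) / qfact p M ^+ 2.
Proof.
rewrite /qbin; have -> : (M <= 2 * M)%N by lia.
by have -> : (2 * M - M = M)%N by lia.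
Qed.

Lemma qratioE (M n : nat) : (n <= M)%N ->
  qratio M (M + n) = qfact p M ^+ 2 / (qfact p (M + n) * qfact p (M - n)) /\
  qratio M (M - n) = qfact p M ^+ 2 / (qfact p (M + n) * qfact p (M - n)).
Proof.
move=> nM; rewrite /qratio qbin_mid /qbin.
have -> : (M + n <= 2 * M)%N by lia.
have -> : (M - n <= 2 * M)%N by lia.
have -> : (2 * M - (M + n) = M - n)%N by lia.
have -> : (2 * M - (M - n) = M + n)%N by lia.
by split; field; rewrite !qf0.
Qed.

(** Going from n to n + 1 multiplies the right-hand side by (1 - p^(M+n+1)) / (1 - p^(M-n)), which
    is at least 1. *)
Lemma qfact_logconcave (M n : nat) : (n <= M)%N ->
  qfact p M ^+ 2 <= qfact p (M + n) * qfact p (M - n).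
Proof.
elim: n => [|n IH] nM; first by rewrite addn0 subn0.
apply: le_trans (IH (ltnW nM)) _.
have -> : (M - n = (M - n.+1).+1)%N by lia.
rewrite addnS !qfactS [leRHS]mulrAC [leLHS]mulrA.
apply: ler_wpM2l; first by rewrite mulr_ge0// ltW ?qfact_gt0.
rewrite lerD2l lerN2.
by apply: ler_wiXn2l => //; lia.
Qed.

Lemma qratio_le1 (M n : nat) : (n <= M)%N -> qratio M (M + n) <= 1 /\ qratio M (M - n) <= 1.
Proof.
move=> nM; have [-> ->] := qratioE nM.
by rewrite ler_pdivrMr ?mulr_gt0 ?qfact_gt0// mul1r qfact_logconcave.
Qed.

Lemma qratio_ge0 (M k : nat) : 0 <= qratio M k.
Proof.
have q0 r i : 0 <= qbin p r i.
  rewrite /qbin; case: ifP => // _.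
  by rewrite divr_ge0 ?mulr_ge0// ltW ?qfact_gt0.
by rewrite divr_ge0.
Qed.

(** The inequality prod (1 - u_i) >= 1 - sum u_i, with u_i = p^(m+i+1) enlarged to p^(m+i). *)
Lemma qfact_add_ge (m n : nat) :
  qfact p m * (1 - p ^+ m / (1 - p)) <= qfact p (m + n).
Proof.
have p1 : 0 < 1 - p by rewrite subr_gt0; case/andP: p01.
apply: (@le_trans _ _ (qfact p m * (1 - \sum_(i < n) p ^+ (m + i)))).
  rewrite ler_wpM2l ?(ltW (qfact_gt0 _ _))// lerD2l lerN2.
  under eq_bigr do rewrite exprD; rewrite -mulr_sumr ler_wpM2l ?exprn_ge0//.
  by rewrite -(big_mkord xpredT) sum_geo_nat ?iota_uniq// p_ge0; case/andP: p01.
elim: n => [|n IH]; first by rewrite big_ord0 addn0 subr0 mulr1.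
rewrite addnS qfactS big_ord_recr/=.
have f0 := ltW (qfact_gt0 p01 (m + n)).
have u0 : 0 <= p ^+ (m + n).+1 by rewrite exprn_ge0.
have ut : p ^+ (m + n).+1 <= p ^+ (m + n) by rewrite exprS ler_piMl// exprn_ge0.
have ba : qfact p (m + n) <= qfact p m.
  rewrite qfact_add ler_piMr ?(ltW (qfact_gt0 _ _))//; apply: prodr_ile1 => i _.
  by rewrite subr_ge0 ltW//= gerBl exprn_ge0.
have := ler_pM f0 u0 ba ut; lra.
Qed.

(** In the formula of [qratioE], one factor [qfact p M] is at least [qfact p (M + n)], and the other
    is compared with [qfact p (M - n)] by [qfact_add_ge]. *)
Lemma qratio_ge (M n : nat) : (n <= M)%N ->
  1 - p ^+ (M - n) / (1 - p) <= qratio M (M + n) /\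
  1 - p ^+ (M - n) / (1 - p) <= qratio M (M - n).
Proof.
move=> nM; have [-> ->] := qratioE nM.
suff h : 1 - p ^+ (M - n) / (1 - p) <=
    qfact p M ^+ 2 / (qfact p (M + n) * qfact p (M - n)) by [].
have f0 := qfact_gt0 p01.
rewrite ler_pdivlMr ?mulr_gt0// mulrCA.
have := qfact_add_ge (M - n) n; rewrite subnK// => h.
have g : qfact p (M + n) <= qfact p M.
  rewrite qfact_add ler_piMr ?(ltW (f0 _))//; apply: prodr_ile1 => i _.
  by rewrite subr_ge0 ltW//= gerBl exprn_ge0.
rewrite expr2; apply: le_trans (_ : qfact p (M + n) * qfact p M <= _).
  by rewrite ler_wpM2l ?(ltW (f0 _))// mulrC.
by rewrite ler_wpM2r ?(ltW (f0 _)).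
Qed.

End CentralRatio.

(** * Gaussian convolution with offset x as a product of shifts *)

Section ThetaLowerBound.
Variables (R : realType) (al x : R).
Hypotheses (al_gt0 : 0 < al) (x_ge0 : 0 <= x) (x_le : x <= 4^-1).

Let p : R := expR (- (2 * al)).
Let p01 : 0 < p < 1.
Proof. by rewrite /p expR_gt0 expR_lt1 oppr_lt0 mulr_gt0. Qed.
Let c : R := expR (- (al / 2)).
Let c01 : 0 < c < 1.
Proof. by rewrite /c expR_gt0 expR_lt1 oppr_lt0 divr_gt0. Qed.

Let x2 : 0 <= 2^-1 - 2 * x.
Proof. by rewrite subr_ge0 mulrC -ler_pdivlMr// -invfM -natrM. Qed.

(* The two inner factors bound prod (1 - c p^l) and prod (1 - p^(l+1)) from below,
   and al / 16 >= al x^2. *)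
Definition theta_low : R :=
  expR (- (al / 16)) *
  (expR (- (c / (1 - c) / (1 - p))) * expR (- (p / (1 - p) / (1 - p)))) ^+ 2.

Let K0 : R := expR (- (c / (1 - c) / (1 - p))).
Let K1 : R := expR (- (p / (1 - p) / (1 - p))).

Let w (M : nat) : R := expR (- (al * (2 * x + 1 - 2 * M%:R))).

Lemma bin2R (k : nat) : 2 * 'C(k, 2)%:R = k%:R ^+ 2 - k%:R :> R.
Proof.
elim: k => [|k IH]; first by rewrite bin0n /= expr0n mulr0 subr0.
by rewrite binS bin1 natrD mulrDr IH -natr1; ring.
Qed.

(* With p = exp (- 2 al) and this choice of [w], the q-binomial coefficients are
   Gaussians centered at M - x, up to the factors [qbin]. *)
Lemma qcoef_gauss (M k : nat) :
  qcoef p (w M) (2 * M) k = expR (al * (x - M%:R) ^+ 2) *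
    (qbin p (2 * M) k * expR (- (al * (x + (k%:R - M%:R)) ^+ 2))).
Proof.
rewrite /qcoef -mulrA [RHS]mulrCA; congr (_ * _).
rewrite /p /w -!expRM_natr -!expRD; congr expR.
have := bin2R k; move: ('C(k, 2)%:R) => b bE.
have -> : b = (k%:R ^+ 2 - k%:R) / 2 by lra.
by field.
Qed.

Lemma prod_expR_odd (M : nat) :
  \prod_(l < M) expR (al * (1 + 2 * l%:R - 2 * x)) = expR (al * (M%:R ^+ 2 - 2 * x * M%:R)).
Proof.
elim: M => [|M IH]; first by rewrite big_ord0 expr0n mulr0 subr0 mulr0 expR0.
by rewrite big_ord_recr/= IH -expRD -natr1; congr expR; ring.
Qed.

(** The factors are 1 - exp (al (2M - 2m - 1 - 2x)). For m = M + i they are at least 1 - c p^i. For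
    m = M - 1 - i they are negative, of absolute value at least exp (al (1 + 2i - 2x)) (1 - c p^i),
    and these exponentials multiply to [prod_expR_odd]. The extreme case x = 1/4 dictates c = exp (-
    al / 2). *)
Lemma prod_w (M : nat) :
  (expR (al * (x - M%:R) ^+ 2) * expR (- (al / 16)) * K0 ^+ 2) ^+ 2 <=
  \prod_(m < 2 * M) (1 - w M * p ^+ m) ^+ 2.
Proof.
have low l : 0 <= 1 - c * p ^+ l.
  case/andP: c01 => c0 c1; case/andP: p01 => p0 p1.
  rewrite subr_ge0; apply: le_trans (ltW c1).
  by rewrite ler_piMr ?(ltW c0)// exprn_ile1 ?ltW.
have K0le : K0 <= \prod_(l < M) (1 - c * p ^+ l).
  apply: prod_geo_ge.
    by case/andP: c01 => /ltW -> ->.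
  by case/andP: p01 => /ltW -> ->.
have K0g : 0 <= K0 by exact: expR_ge0.
have wE m : w M * p ^+ m = expR (al * (2 * M%:R - 2 * m%:R - 1 - 2 * x)).
  by rewrite /w /p -expRM_natr -expRD; congr expR; ring.
have cpE l : c * p ^+ l = expR (- (al * (2^-1 + 2 * l%:R))).
  by rewrite /c /p -expRM_natr -expRD; congr expR; field.
have hi : (\prod_(i < M) (1 - c * p ^+ i)) ^+ 2 <=
    \prod_(i < M) (1 - w M * p ^+ (M + i)) ^+ 2.
  rewrite -prodrXl; apply: ler_prod => i _; rewrite sqr_ge0/=.
  have h : 1 - c * p ^+ i <= 1 - w M * p ^+ (M + i).
    rewrite lerD2l lerN2 wE cpE ler_expR natrD.
    have ax := mulr_ge0 (ltW al_gt0) x_ge0; rewrite -subr_ge0.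
    have -> : - (al * (2^-1 + 2 * i%:R)) - al * (2 * M%:R - 2 * (M%:R + i%:R) - 1 - 2 * x)
      = al / 2 + 2 * (al * x) by field.
    by rewrite addr_ge0 ?divr_ge0 ?mulr_ge0 ?(ltW al_gt0).
  by rewrite ler_pXn2r// nnegrE ?(le_trans (low i)).
have lo : (expR (al * (M%:R ^+ 2 - 2 * x * M%:R)) *
    \prod_(i < M) (1 - c * p ^+ i)) ^+ 2 <=
    \prod_(i < M) (1 - w M * p ^+ i) ^+ 2.
  rewrite -prod_expR_odd -big_split/= -prodrXl.
  rewrite [leRHS](reindex_inj rev_ord_inj)/=.
  apply: ler_prod => i _; rewrite sqr_ge0/= -[leRHS]sqrrN opprB.
  have h : expR (al * (1 + 2 * i%:R - 2 * x)) * (1 - c * p ^+ i) <=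
      w M * p ^+ (M - i.+1) - 1.
    rewrite mulrBr mulr1 wE cpE natrB// -natr1 -expRD; apply: lerB.
      by rewrite ler_expR; lra.
    rewrite -[leLHS]expR0 ler_expR.
    have -> : al * (1 + 2 * i%:R - 2 * x) - al * (2^-1 + 2 * i%:R) = al * (2^-1 - 2 * x).
      by field.
    by rewrite mulr_ge0// ltW.
  have h0 : 0 <= expR (al * (1 + 2 * i%:R - 2 * x)) * (1 - c * p ^+ i).
    by rewrite mulr_ge0 ?expR_ge0.
  by rewrite ler_pXn2r// nnegrE ?(le_trans h0).
rewrite mul2n -addnn big_split_ord/=.
apply: le_trans (ler_pM (sqr_ge0 _) (sqr_ge0 _) lo hi).
rewrite -exprMn ler_pXn2r ?nnegrE//; last 2 first.
- by rewrite !mulr_ge0 ?expR_ge0 ?exprn_ge0.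
- by rewrite !mulr_ge0 ?expR_ge0 ?prodr_ge0.
rewrite -[leRHS]mulrA -expr2 -expRD; apply: ler_pM.
- exact: expR_ge0.
- exact: exprn_ge0.
- have xx : x ^+ 2 <= 16^-1.
    have -> : (16^-1 : R) = 4^-1 ^+ 2 by field.
    by rewrite ler_pXn2r// nnegrE.
  rewrite ler_expR -subr_ge0.
  have -> : al * (M%:R ^+ 2 - 2 * x * M%:R) - (al * (x - M%:R) ^+ 2 - al / 16) =
    al * (16^-1 - x ^+ 2) by field.
  by rewrite mulr_ge0 ?subr_ge0// ltW.
- by rewrite ler_pXn2r// nnegrE// (le_trans K0g).
Qed.

(** Dividing the q-binomial bound by E = exp (al (x - M)^2) and by the central coefficient g makes
    it independent of M: E cancels against [prod_w], and g K1^2 <= 1 because [qfact p (2 * M)] <= 1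
    and K1 <= [qfact p M]. *)
Lemma pnormsq_theta (N M : nat) (Z : int -> R) : periodic N Z ->
  theta_low ^+ 2 * pnormsq N Z <=
  pnormsq N (fun n => \sum_(k < (2 * M).+1)
    qratio p M k * expR (- (al * (x + (k%:R - M%:R)) ^+ 2)) * Z (n - k%:Z)).
Proof.
move=> pZ; have := pnormsq_qbinomial (2 * M) p01 (expR_ge0 _ : 0 <= w M) pZ.
pose E := expR (al * (x - M%:R) ^+ 2).
have E0 : 0 < E by exact: expR_gt0.
have p0 : 0 <= p by exact: expR_ge0.
pose g := qbin p (2 * M) M.
have f0 := qfact_gt0 p01.
have g0 : 0 < g by rewrite /g (qbin_mid p01) divr_gt0 ?exprn_gt0.
set Y := fun n => \sum_(k < (2 * M).+1)
    qratio p M k * expR (- (al * (x + (k%:R - M%:R)) ^+ 2)) * Z (n - k%:Z).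
have -> : pnormsq N (fun n => \sum_(k < (2 * M).+1) qcoef p (w M) (2 * M) k * Z (n - k%:Z))
    = (E * g) ^+ 2 * pnormsq N Y.
  rewrite /pnormsq mulr_sumr; apply: eq_bigr => i _; rewrite -exprMn; congr (_ ^+ 2).
  rewrite mulr_sumr; apply: eq_bigr => k _; rewrite qcoef_gauss /qratio -/g -/E.
  by field; rewrite gt_eqF.
move=> h; rewrite -(ler_pM2l (exprn_gt0 2 (mulr_gt0 E0 g0))).
apply: le_trans h; rewrite mulrA ler_wpM2r ?sumr_ge0//.
  by move=> i _; rewrite sqr_ge0.
apply: le_trans (prod_w M); rewrite -exprMn.
have K1M : K1 <= qfact p M.
  rewrite /qfact; under eq_bigr do rewrite exprS.
  by case/andP: p01 => p1 p2; apply: prod_geo_ge; rewrite p2 ltW.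
have gK : g * K1 ^+ 2 <= 1.
  rewrite /g (qbin_mid p01) mulrAC ler_pdivrMr ?exprn_gt0// mul1r.
  apply: le_trans (_ : K1 ^+ 2 <= _).
    by rewrite ler_piMl ?sqr_ge0 ?qfact_le1.
  by rewrite ler_pXn2r// nnegrE ?expR_ge0 ?(ltW (f0 _)).
rewrite ler_pXn2r ?nnegrE /theta_low -/K0 -/K1.
- have -> : E * g * (expR (- (al / 16)) * (K0 * K1) ^+ 2) =
    E * expR (- (al / 16)) * K0 ^+ 2 * (g * K1 ^+ 2) by ring.
  by rewrite ler_piMr// !mulr_ge0 ?expR_ge0 ?exprn_ge0 ?expR_ge0.
- by [].
- by rewrite !mulr_ge0 ?expR_ge0 ?exprn_ge0 ?mulr_ge0 ?expR_ge0 ?(ltW g0).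
- by rewrite !mulr_ge0 ?expR_ge0 ?exprn_ge0 ?mulr_ge0 ?expR_ge0.
Qed.

(** The left-hand side is the loss at offset n when the Gaussian is replaced by its truncated
    q-binomial version. The first factor is at most exp (- 2 al (M - |n|)) / (1 - p) in both cases,
    and the Gaussian decay in n outweighs the growth in |n|. *)
Lemma gauss_tail (M : nat) (n : int) :
  (if (`|n| <= M)%N then 1 - qratio p M `|(n + M%:Z)%R|%N else 1) *
    expR (- (al * (x + n%:~R) ^+ 2)) <=
  expR (4 * al) / (1 - p) * expR (- (2 * al * M%:R)) * expR (- al) ^+ `|n|%N.
Proof.
have p1 : 0 < 1 - p by rewrite subr_gt0; case/andP: p01.
have p0 : 0 <= p by exact: expR_ge0.
have q1 : 1 <= (1 - p)^-1 by rewrite -[leLHS]invr1 lef_pV2 ?posrE// gerBl.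
have nE : `|n|%N%:R = `|n%:~R| :> R by rewrite -intr_norm; case: (n).
pose t : R := `|n%:~R|.
have c1 : (if (`|n| <= M)%N then 1 - qratio p M `|(n + M%:Z)%R|%N else 1) <=
    (1 - p)^-1 * expR (- (2 * al * (M%:R - t))).
  case: leqP => nM; last first.
    rewrite -[leLHS]mul1r ler_pM// -[leLHS]expR0 ler_expR oppr_ge0.
    apply: mulr_ge0_le0; first by rewrite mulr_ge0// ltW.
    by rewrite subr_le0 /t -nE ler_nat ltnW.
  have -> : expR (- (2 * al * (M%:R - t))) = p ^+ (M - `|n|).
    by rewrite /p -expRM_natr; congr expR; rewrite natrB// nE -/t; ring.
  have [h1 h2] := qratio_ge p01 nM.
  rewrite mulrC lerBlDr -lerBlDl.
  have [->|->] : `|(n + M%:Z)%R|%N = (M + `|n|)%N \/ `|(n + M%:Z)%R|%N = (M - `|n|)%N by lia.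
    exact: h1.
  exact: h2.
have c2 : expR (- (al * (x + n%:~R) ^+ 2)) <= expR (- (al * (t ^+ 2 - t / 2))).
  rewrite ler_expR lerN2 ler_pM2l//.
  have -> : t ^+ 2 = n%:~R ^+ 2 by rewrite real_normK ?num_real.
  have nt : 0 <= n%:~R + t.
    by rewrite -lerBlDr sub0r lerNl /t -normrN ler_norm.
  have h1 := mulr_ge0 x_ge0 nt.
  have h2 : 0 <= t * (2^-1 - 2 * x) by rewrite mulr_ge0// /t normr_ge0.
  rewrite -subr_ge0.
  have -> : (x + n%:~R) ^+ 2 - (n%:~R ^+ 2 - t / 2) =
    x ^+ 2 + 2 * (x * (n%:~R + t)) + t * (2^-1 - 2 * x) by field.
  by rewrite addr_ge0// addr_ge0 ?sqr_ge0// mulr_ge0.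
apply: le_trans (_ : (1 - p)^-1 * expR (- (2 * al * (M%:R - t))) *
    expR (- (al * (t ^+ 2 - t / 2))) <= _).
  apply: le_trans (_ : (1 - p)^-1 * expR (- (2 * al * (M%:R - t))) *
    expR (- (al * (x + n%:~R) ^+ 2)) <= _).
    by rewrite ler_wpM2r ?expR_ge0.
  by rewrite ler_wpM2l// mulr_ge0 ?expR_ge0// invr_ge0 ltW.
rewrite -expRM_natr nE -/t -mulrA -expRD [expR (4 * al) / _]mulrC -!mulrA -!expRD.
rewrite ler_wpM2l ?invr_ge0 ?(ltW p1)// ler_expR.
(* The exponents compare exactly when t^2 - 7t/2 + 4 >= 0; the constant 4 al in the statement makes
   the discriminant negative. *)
have : 0 <= al * (t ^+ 2 - 7 / 2 * t + 4).
  have -> : t ^+ 2 - 7 / 2 * t + 4 = (t - 7 / 4) ^+ 2 + 15 / 16 by field.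
  by rewrite mulr_ge0 ?(ltW al_gt0)// addr_ge0 ?sqr_ge0.
move=> h; rewrite -subr_ge0; apply: le_trans h _.
by rewrite le_eqVlt; apply/orP; left; apply/eqP; field.
Qed.

End ThetaLowerBound.

(** Cauchy-Schwarz with weights D i j, here from Lagrange's identity, uses the row sums; exchanging
    the sums then uses the column sums. *)
Lemma schur_test (R : realFieldType) (m n : nat) (D : 'I_m -> 'I_n -> R) (z : 'I_n -> R) (e : R) :
  (forall i j, 0 <= D i j) -> 0 <= e ->
  (forall i, \sum_j D i j <= e) -> (forall j, \sum_i D i j <= e) ->
  \sum_i (\sum_j D i j * z j) ^+ 2 <= e ^+ 2 * \sum_j z j ^+ 2.
Proof.
move=> D0 e0 Dr Dc.
have cs i : (\sum_j D i j * z j) ^+ 2 <= (\sum_j D i j) * \sum_j D i j * z j ^+ 2.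
  rewrite -subr_ge0 -(pmulr_lge0 _ (ltr0n _ 2 : 0 < 2)).
  suff -> : ((\sum_j D i j) * (\sum_j D i j * z j ^+ 2) - (\sum_j D i j * z j) ^+ 2) * 2 =
      \sum_j \sum_k D i j * D i k * (z j - z k) ^+ 2.
    by apply: sumr_ge0 => j _; apply: sumr_ge0 => k _; rewrite mulr_ge0 ?sqr_ge0// mulr_ge0.
  have -> : \sum_j \sum_k D i j * D i k * (z j - z k) ^+ 2 =
      \sum_j \sum_k (D i j * z j ^+ 2 * D i k + D i j * (D i k * z k ^+ 2)
        - 2 * (D i j * z j * (D i k * z k))).
    by apply: eq_bigr => j _; apply: eq_bigr => k _; ring.
  under [RHS]eq_bigr do rewrite sumrB big_split/= -!mulr_sumr.
  by rewrite [RHS]sumrB big_split/= -!mulr_suml -mulr_sumr -mulr_suml; ring.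
apply: (@le_trans _ _ (\sum_i e * \sum_j D i j * z j ^+ 2)).
  apply: ler_sum => i _; apply: le_trans (cs i) _; rewrite ler_wpM2r//.
  by apply: sumr_ge0 => j _; rewrite mulr_ge0 ?sqr_ge0.
rewrite -mulr_sumr expr2 -mulrA ler_wpM2l// exchange_big/= mulr_sumr.
apply: ler_sum => j _; rewrite -mulr_suml ler_wpM2r ?sqr_ge0//.
Qed.

Lemma periodic_modz (R : realType) (N : nat) (Z : int -> R) (n : int) :
  periodic N Z -> Z (n %% N)%Z = Z n.
Proof.
move=> pZ; rewrite [in RHS](divz_eq n N) addrC.
have step k a : Z (a + k%:Z * N%:Z) = Z a.
  elim: k => [|k IH] in a *; first by rewrite mul0r addr0.
  by rewrite -(pZ (a + _)) -[RHS]IH; congr Z; lia.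
case: (n %/ N)%Z => k; first by rewrite step.
by rewrite -[RHS](step k.+1); congr Z; rewrite NegzE; ring.
Qed.

Lemma ord_eq_mod (N : nat) (i j : 'I_N) (r : int) :
  i%:Z - j%:Z = r * N%:Z -> i = j.
Proof.
move=> ij; apply: val_inj => /=; have iN := ltn_ord i; have jN := ltn_ord j.
have : (i%:Z %% N)%Z = (j%:Z %% N)%Z.
  by have -> : i%:Z = r * N%:Z + j%:Z; [lia|rewrite modzMDl].
by rewrite !modz_small; lia.
Qed.

(** * Riesz bound for the periodized Gaussian *)

Section Riesz.
Variables (R : realType) (al x : R) (N : nat).
Hypotheses (al_gt0 : 0 < al) (x_ge0 : 0 <= x) (x_le : x <= 4^-1) (N_gt0 : (0 < N)%N).

Let p : R := expR (- (2 * al)).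
Let p01 : 0 < p < 1.
Proof. by rewrite /p expR_gt0 expR_lt1 oppr_lt0 mulr_gt0. Qed.
Let e (u : R) : R := expR (- (al * u ^+ 2)).
Let e_ge0 u : 0 <= e u. Proof. exact: expR_ge0. Qed.
Let c (M k : nat) : R := qratio p M k * e (x + (k%:R - M%:R)).
Let c_ge0 M k : 0 <= c M k. Proof. by rewrite mulr_ge0// qratio_ge0. Qed.

(** The bound of [gauss_tail] summed over all n; it tends to 0 as M grows. *)
Let eps (M : nat) : R :=
  expR (4 * al) / (1 - p) * expR (- (2 * al * M%:R)) * (2 / (1 - expR (- al))).

Let eps_ge0 M : 0 <= eps M.
Proof.
have [p0 p1] := andP p01.
rewrite /eps !mulr_ge0 ?expR_ge0 ?invr_ge0 ?subr_ge0 ?(ltW p1)//.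
by rewrite expR_le1 oppr_le0 ltW.
Qed.

Lemma gauss_sum_trunc (M : nat) (s : seq int) : uniq s ->
  \sum_(n <- s) e (x + n%:~R) <= \sum_(k < (2 * M).+1) c M k + eps M.
Proof.
move=> us.
pose F (n : int) := qratio p M `|(n + M%:Z)%R|%N * e (x + n%:~R).
pose a (n : int) := if (`|n| <= M)%N then 1 - qratio p M `|(n + M%:Z)%R|%N else 1.
have -> : \sum_(n <- s) e (x + n%:~R) =
    \sum_(n <- s | (`|n| <= M)%N) F n + \sum_(n <- s) a n * e (x + n%:~R).
  rewrite [X in _ = X + _]big_mkcond -big_split/=; apply: eq_bigr => n _.
  by rewrite /a /F; case: ifP => _; move: (e _) => u; ring.
apply: lerD; last first.
  apply: (@le_trans _ _ (\sum_(n <- s) expR (4 * al) / (1 - p) *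
      expR (- (2 * al * M%:R)) * expR (- al) ^+ `|n|%N)).
    by apply: ler_sum => n _; exact: gauss_tail.
  rewrite -mulr_sumr ler_wpM2l//.
    by rewrite !mulr_ge0 ?expR_ge0// invr_ge0 subr_ge0 ltW//; case/andP: p01.
  by rewrite sum_geo_int// expR_ge0 expR_lt1 oppr_lt0.
rewrite -big_filter.
apply: (@le_trans _ _ (\sum_(n <- [seq k%:Z - M%:Z | k <- iota 0 (2 * M).+1]) F n)).
  apply: ler_sum_subseq.
  - by move=> n; rewrite mulr_ge0// qratio_ge0.
  - by rewrite filter_uniq.
  - by rewrite map_inj_uniq ?iota_uniq// => i j; lia.
  move=> n; rewrite mem_filter => /andP[nM _]; apply/mapP.
  by exists `|(n + M%:Z)%R|%N; rewrite ?mem_iota; lia.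
rewrite big_map le_eqVlt; apply/orP; left; apply/eqP.
rewrite -[in LHS]/(index_iota 0 (2 * M).+1) big_mkord; apply: eq_bigr => k _.
rewrite /F /c; congr (qratio _ _ _ * e (_ + _)); first by lia.
by rewrite intrB.
Qed.

(** The truncated convolution folded modulo N. The index k stands for the offset k - M; the
    congruence omits M because M will be a multiple of N. *)
Let S (M : nat) (n j : int) : R :=
  \sum_(k < (2 * M).+1 | (k%:Z == n - j %[mod N])%Z) c M k.

Lemma sum_trunc_row (M : nat) (Z : int -> R) (n : int) : periodic N Z ->
  \sum_(j < N) S M n j * Z j = \sum_(k < (2 * M).+1) c M k * Z (n - k%:Z).
Proof.
move=> pZ; rewrite /S; under eq_bigr do rewrite mulr_suml big_mkcond/=.
rewrite exchange_big/=; apply: eq_bigr => k _; rewrite -big_mkcond/=.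
have jN : (`|((n - k%:Z) %% N)%Z|%N < N)%N by lia.
rewrite (big_pred1 (Ordinal jN)) => [|j /=].
  by rewrite -(periodic_modz (n - _) pZ); congr (_ * Z _); rewrite /=; lia.
rewrite eqz_mod_dvd; apply/idP/eqP => [/dvdzP[m mE]|->].
  apply: val_inj => /=.
  have -> : n - k%:Z = (- m) * N%:Z + j%:Z by rewrite mulNr -mE; ring.
  by have jN0 := ltn_ord j; rewrite modzMDl modz_small; lia.
apply/dvdzP => /=; exists (- ((n - k%:Z) %/ N)%Z).
have := divz_eq (n - k%:Z) N; have : 0 <= ((n - k%:Z) %% N)%Z by lia.
lia.
Qed.

Lemma sum_trunc_col (M : nat) (j : int) :
  \sum_(i < N) S M i j = \sum_(k < (2 * M).+1) c M k.
Proof.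
rewrite /S; under eq_bigr do rewrite big_mkcond/=.
rewrite exchange_big/=; apply: eq_bigr => k _; rewrite -big_mkcond/=.
have iN : (`|((j + k%:Z) %% N)%Z|%N < N)%N by lia.
rewrite (big_pred1 (Ordinal iN))// => i /=.
rewrite eqz_mod_dvd; apply/idP/eqP => [/dvdzP[m mE]|->].
  apply: val_inj => /=.
  have -> : j + k%:Z = m * N%:Z + i%:Z by lia.
  by have iN0 := ltn_ord i; rewrite modzMDl modz_small; lia.
apply/dvdzP => /=; exists ((j + k%:Z) %/ N)%Z.
have := divz_eq (j + k%:Z) N; have : 0 <= ((j + k%:Z) %% N)%Z by lia.
lia.
Qed.

(** As N divides M, the indices k in the class of n - j give distinct periods m k, and [qratio] is
    at most 1, so the folded sum is dominated by a subsum of the periodization. *)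
Lemma trunc_le_gper (M : nat) (n j : int) : (N %| M)%N ->
  S M n j <= gper al N (x + (n - j)%:~R).
Proof.
case/dvdnP => M' ME; rewrite /S.
pose m (k : nat) := ((n - j - (k%:Z - M%:Z)) %/ N)%Z.
pose P (k : nat) := (k%:Z == n - j %[mod N])%Z.
have mE k : P k -> k%:Z - M%:Z = (n - j) - m k * N%:Z.
  rewrite /P eqz_mod_dvd => /dvdzP[r rE].
  rewrite /m; have -> : n - j - (k%:Z - M%:Z) = (M'%:Z - r) * N%:Z by lia.
  by rewrite mulzK; lia.
apply: (@le_trans _ _ (\sum_(k <- [seq m k | k <- iota 0 (2 * M).+1 & P k])
   expR (- (al * (x + (n - j)%:~R - k%:~R * N%:R) ^+ 2)))); last first.
  apply: gper_ge_sum => //; rewrite map_inj_in_uniq ?filter_uniq ?iota_uniq//.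
  move=> k l; rewrite !mem_filter => /andP[/mE kE _] /andP[/mE lE _] kl.
  by move: kE lE; rewrite kl; lia.
rewrite big_map big_filter -[iota 0 _]/(index_iota 0 (2 * M).+1) big_mkord.
apply: ler_sum => k /mE kE; rewrite /c.
have -> : x + (n - j)%:~R - (m k)%:~R * N%:R = x + (k%:R - M%:R).
  rewrite -addrA; congr (_ + _); have := congr1 (fun z : int => z%:~R : R) kE.
  by rewrite !intrB intrM => /= ->.
rewrite ler_piMl//.
have kM : (k < (2 * M).+1)%N by [].
have [kM'|Mk] := leqP k M.
  by have [_] := qratio_le1 p01 (leq_subr k M); rewrite subKn.
have lM : (k - M <= M)%N by lia.
by have [+ _] := qratio_le1 p01 lM; rewrite subnKC// ltnW.
Qed.

(** The difference D of the full and the truncated kernel is nonnegative with row and column sums at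
    most [eps M], so Schur's test bounds it; the factor 1/2 comes from v^2 <= 2 u^2 + 2 (u -
    v)^2. *)
Lemma riesz_trunc (M : nat) (Z : int -> R) : (N %| M)%N -> periodic N Z ->
  (theta_low al ^+ 2 / 2 - eps M ^+ 2) * pnormsq N Z <=
  pnormsq N (fun n => \sum_(j < N) gper al N (x + (n - j%:Z)%:~R) * Z j%:Z).
Proof.
move=> NM pZ.
pose D (i j : 'I_N) := gper al N (x + (i%:Z - j%:Z)%:~R) - S M i%:Z j%:Z.
have eps0 := eps_ge0 M.
have D0 i j : 0 <= D i j by rewrite subr_ge0 trunc_le_gper.
have Dr i : \sum_j D i j <= eps M.
  rewrite sumrB lerBlDr addrC.
  have -> : \sum_(j < N) S M i j = \sum_(k < (2 * M).+1) c M k.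
    have := @sum_trunc_row M (fun=> 1) i (fun=> erefl).
    by under eq_bigr do rewrite mulr1; move=> ->; under eq_bigr do rewrite mulr1.
  apply: (@sum_gper_le _ _ _ al_gt0 N_gt0 _ _ (fun j : 'I_N => i%:Z - j%:Z)); last first.
    exact: gauss_sum_trunc.
  move=> j k /eqP; rewrite eqz_mod_dvd => /dvdzP[r rE].
  by apply/esym/(@ord_eq_mod _ _ _ r); lia.
have Dc j : \sum_i D i j <= eps M.
  rewrite sumrB lerBlDr addrC sum_trunc_col.
  apply: (@sum_gper_le _ _ _ al_gt0 N_gt0 _ _ (fun i : 'I_N => i%:Z - j%:Z)); last first.
    exact: gauss_sum_trunc.
  move=> i k /eqP; rewrite eqz_mod_dvd => /dvdzP[r rE].
  by apply: (@ord_eq_mod _ _ _ r); lia.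
have := schur_test (fun j => Z j%:Z) D0 eps0 Dr Dc.
have := pnormsq_theta al_gt0 x_ge0 x_le M pZ; rewrite -/p.
set CZ := fun n => \sum_(j < N) gper al N (x + (n - j%:Z)%:~R) * Z j%:Z.
set t := fun n => \sum_(k < (2 * M).+1) _.
rewrite -/(pnormsq N Z) => h1 h2.
have h3 : pnormsq N t <= 2 * pnormsq N CZ + 2 * \sum_i (\sum_j D i j * Z j%:Z) ^+ 2.
  rewrite /pnormsq !mulr_sumr -big_split/=; apply: ler_sum => i _.
  have -> : \sum_j D i j * Z j%:Z = CZ i%:Z - t i%:Z.
    rewrite /CZ /t -(sum_trunc_row M i%:Z pZ) -sumrB; apply: eq_bigr => j _.
    by rewrite /D mulrBl.
  move: (CZ _) (t _) => u v; rewrite -subr_ge0.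
  have -> : 2 * u ^+ 2 + 2 * (u - v) ^+ 2 - v ^+ 2 = (2 * u - v) ^+ 2 by ring.
  exact: sqr_ge0.
have n0 : 0 <= pnormsq N Z by apply: sumr_ge0 => i _; rewrite sqr_ge0.
lra.
Qed.

Lemma gper_riesz (Z : int -> R) : periodic N Z ->
  theta_low al ^+ 2 / 4 * pnormsq N Z <=
  pnormsq N (fun n => \sum_(j < N) gper al N (x + (n - j%:Z)%:~R) * Z j%:Z).
Proof.
move=> pZ.
have th0 : 0 < theta_low al by rewrite mulr_gt0 ?exprn_gt0 ?mulr_gt0 ?expR_gt0.
have [p0 p1] := andP p01.
have q1 : expR (- al) < 1 by rewrite expR_lt1 oppr_lt0.
pose K := expR (4 * al) / (1 - p) * (2 / (1 - expR (- al))).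
have K0 : 0 < K.
  by rewrite !mulr_gt0 ?expR_gt0 ?invr_gt0 ?subr_gt0.
(* Since exp u >= u, [eps M] <= K / (2 al M'). This choice makes it at most half of [theta_low al],
   so that theta^2 / 2 - theta^2 / 4 remains. *)
pose M' := Num.bound (2 * K / (2 * al * theta_low al)).
have bM : 2 * K < 2 * al * theta_low al * M'%:R.
  have d0 : 0 < 2 * al * theta_low al by apply: mulr_gt0 => //; apply: mulr_gt0.
  rewrite -ltr_pdivrMl// mulrC.
  have := archi_boundP (_ : 0 <= 2 * K / (2 * al * theta_low al)); apply.
  by apply: ltW; apply: divr_gt0 => //; apply: mulr_gt0.
(* N %| M makes the shift by M of the product trivial on periodic sequences. *)
pose M := (M' * N)%N.
apply: le_trans (riesz_trunc (dvdn_mull M' (dvdnn N) : (N %| M)%N) pZ).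
rewrite ler_wpM2r//; first by apply: sumr_ge0 => i _; rewrite sqr_ge0.
have e0 := eps_ge0 M.
suff eM : eps M <= theta_low al / 2.
  have : eps M ^+ 2 <= (theta_low al / 2) ^+ 2.
    by rewrite ler_pXn2r ?nnegrE// divr_ge0// ltW.
  rewrite expr_div_n; lra.
have -> : eps M = K * expR (- (2 * al * M%:R)) by rewrite /eps /K; ring.
rewrite expRN ler_pdivrMr ?expR_gt0//.
have h1 : 2 * al * M'%:R <= expR (2 * al * M%:R).
  apply: le_trans (_ : 2 * al * M%:R <= _).
    rewrite ler_wpM2l ?mulr_ge0 ?(ltW al_gt0)// ler_nat.
    by rewrite /M leq_pmulr.
  by apply: le_trans (expR_ge1Dx _); rewrite lerDr.
apply: le_trans (_ : theta_low al / 2 * (2 * al * M'%:R) <= _); first by lra.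
by rewrite ler_wpM2l// divr_ge0// ltW.
Qed.

End Riesz.

(** * Gram matrices and ridge regression *)

Section Euclidean.
Variable R : realFieldType.

Definition dot (n : nat) (u v : 'cV[R]_n) : R := (u^T *m v) 0 0.
Definition normsq (n : nat) (u : 'cV[R]_n) : R := dot u u.

Lemma dotE n (u v : 'cV[R]_n) : dot u v = \sum_i u i 0 * v i 0.
Proof. by rewrite /dot mxE; apply: eq_bigr => i _; rewrite mxE. Qed.

Lemma normsqE n (u : 'cV[R]_n) : normsq u = \sum_i u i 0 ^+ 2.
Proof. by rewrite /normsq dotE. Qed.

Lemma normsq_ge0 n (u : 'cV[R]_n) : 0 <= normsq u.
Proof. by rewrite normsqE sumr_ge0// => i _; rewrite sqr_ge0. Qed.

Lemma dotC n (u v : 'cV[R]_n) : dot u v = dot v u.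
Proof. by rewrite !dotE; apply: eq_bigr => i _; rewrite mulrC. Qed.

Lemma dot_mull m n (A : 'M[R]_(m, n)) (u : 'cV[R]_n) (v : 'cV[R]_m) :
  dot (A *m u) v = dot u (A^T *m v).
Proof. by rewrite /dot trmx_mul mulmxA. Qed.

Lemma normsqD n (u v : 'cV[R]_n) : normsq (u + v) = normsq u + 2 * dot u v + normsq v.
Proof.
rewrite !normsqE dotE mulr_sumr -!big_split/=; apply: eq_bigr => i _.
by rewrite mxE; ring.
Qed.

Lemma normsqZ n (a : R) (u : 'cV[R]_n) : normsq (a *: u) = a ^+ 2 * normsq u.
Proof. by rewrite !normsqE mulr_sumr; apply: eq_bigr => i _; rewrite mxE exprMn. Qed.

Lemma dotZr n (a : R) (u v : 'cV[R]_n) : dot u (a *: v) = a * dot u v.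
Proof. by rewrite !dotE mulr_sumr; apply: eq_bigr => i _; rewrite mxE; ring. Qed.

Lemma dotZl n (a : R) (u v : 'cV[R]_n) : dot (a *: u) v = a * dot u v.
Proof. by rewrite dotC dotZr dotC. Qed.

Lemma normsq_le0 n (u : 'cV[R]_n) : normsq u <= 0 -> u = 0.
Proof.
move=> u0; have /eqP : normsq u = 0 by apply/eqP; rewrite eq_le u0 normsq_ge0.
rewrite normsqE psumr_eq0 => [/allP u00|i _]; last by rewrite sqr_ge0.
apply/matrixP => i j; rewrite ord1 mxE.
by have /(_ i) := u00; rewrite mem_index_enum sqrf_eq0 => /(_ isT)/eqP.
Qed.

Lemma cauchy_schwarz n (u v : 'cV[R]_n) : dot u v ^+ 2 <= normsq u * normsq v.
Proof.
have [v0|v0] := lerP (normsq v) 0.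
  have -> : v = 0 by exact: normsq_le0.
  rewrite dotE big1 ?expr0n/= ?mulr_ge0 ?normsq_ge0// => i _.
  by rewrite mxE mulr0.
have := normsq_ge0 (normsq v *: u + (- dot u v) *: v).
have -> : normsq (normsq v *: u + (- dot u v) *: v) =
    normsq v * (normsq u * normsq v - dot u v ^+ 2).
  by rewrite normsqD !normsqZ dotZr dotZl; ring.
by rewrite pmulr_rge0// subr_ge0.
Qed.

Lemma posdef_unitmx n (A : 'M[R]_n) (k : R) : 0 < k ->
  (forall z : 'cV[R]_n, k * normsq z <= dot z (A *m z)) -> A \in unitmx.
Proof.
move=> k0 Apos; rewrite -unitmx_tr -row_free_unit -kermx_eq0.
apply/eqP/row_matrixP => i; rewrite row0; set r := row i _.
have rA : r *m A^T = 0 by rewrite /r -row_mul mulmx_ker row0.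
have Ar : A *m r^T = 0 by rewrite -[A]trmxK -trmx_mul rA trmx0.
have := Apos r^T; rewrite Ar /dot mulmx0 mxE pmulr_rle0// => /normsq_le0 r0.
by rewrite -[r]trmxK r0 trmx0.
Qed.

End Euclidean.

Section Gram.
Variables (R : realFieldType) (L N : nat) (Phi : 'M[R]_(L, N)) (k : R).
Hypotheses (k_gt0 : 0 < k)
  (riesz : forall z : 'cV[R]_N, k * normsq z <= normsq (Phi *m z)).

Lemma gram_unitmx : Phi^T *m Phi \in unitmx.
Proof.
by apply: (posdef_unitmx k_gt0) => z; rewrite -mulmxA -dot_mull; exact: riesz.
Qed.

(** For z = (Phi^T Phi)^-1 w, k |z|^2 <= |Phi z|^2 = <z, w>; inserted into |w - k z|^2 >= 0 this
    gives the bound without square roots. *)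
Lemma gram_inv_bound (w : 'cV[R]_N) :
  k ^+ 2 * normsq (invmx (Phi^T *m Phi) *m w) <= normsq w.
Proof.
set z := _ *m w.
have wE : w = Phi^T *m (Phi *m z) by rewrite mulmxA mulKVmx// gram_unitmx.
have h := riesz z; have zw : normsq (Phi *m z) = dot z w by rewrite wE -dot_mull.
have := normsq_ge0 (w + (- k) *: z); rewrite normsqD dotZr normsqZ dotC -zw.
have := ler_wpM2l (ltW k_gt0) h; lra.
Qed.

(** Phi z is the orthogonal projection of v onto the range of Phi, hence |Phi z| <= |v|. *)
Lemma gram_proj_bound (v : 'cV[R]_L) :
  k * normsq (invmx (Phi^T *m Phi) *m (Phi^T *m v)) <= normsq v.
Proof.
set z := _ *m (_ *m v).
have wE : Phi^T *m v = Phi^T *m (Phi *m z).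
  by rewrite [RHS]mulmxA mulKVmx// gram_unitmx.
have zv : dot v (Phi *m z) = normsq (Phi *m z) by rewrite dotC dot_mull wE -dot_mull.
have := normsq_ge0 (v + (- 1) *: (Phi *m z)); rewrite normsqD dotZr normsqZ zv.
have := riesz z; lra.
Qed.

End Gram.

(** Column j of C minimizes |Psi (e_j - C_j)|^2 + lam |C_j|^2 over vectors supported on J, and the
    second claim is the normal equations. With h = e_j - C_j they give <Psi h, Psi C_j> = lam
    |C_j|^2, so Gam_jj = |Psi h|^2 + 2 lam |C_j|^2 + |Psi C_j|^2, which yields the last two
    claims. *)
Lemma ridge (R : realFieldType) (L N : nat) (Psi : 'M[R]_(L, N)) (J : {set 'I_N})
    (lam : R) : 0 < lam -> let Gam := Psi^T *m Psi in
  exists C : 'M[R]_N,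
    [/\ forall i j, i \notin J -> C i j = 0,
        forall i j, i \in J -> (Gam *m (1%:M - C)) i j = lam * C i j,
        forall j, lam * \sum_i C i j ^+ 2 <= Gam j j &
        forall i j, (Gam *m (1%:M - C)) i j ^+ 2 <= Gam i i * Gam j j].
Proof.
move=> lam0 /=.
have [Gam GamE] : exists G, G = Psi^T *m Psi by exists (Psi^T *m Psi).
rewrite -GamE.
pose D : 'M[R]_N := diag_mx (\row_i (i \in J)%:R).
(* The term lam acts on all coordinates: it makes M invertible, and off J the equation for C reduces
   to lam C = 0. *)
pose M := D *m Gam *m D + lam *: 1%:M.
have DT : D^T = D by rewrite /D tr_diag_mx.
have DE (A : 'M[R]_N) i j : (D *m A) i j = (i \in J)%:R * A i j.
  by rewrite mul_diag_mx !mxE.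
have uM : M \in unitmx.
  apply: (posdef_unitmx lam0) => z.
  have -> : M *m z = D *m (Psi^T *m (Psi *m (D *m z))) + lam *: z.
    by rewrite /M mulmxDl -scalemxAl mul1mx GamE !mulmxA.
  have -> : dot z (D *m (Psi^T *m (Psi *m (D *m z))) + lam *: z) =
      normsq (Psi *m (D *m z)) + lam * normsq z.
    rewrite /dot mulmxDr mxE -!/(dot _ _) dotZr; congr (_ + _).
    by rewrite -{1}DT -dot_mull -dot_mull.
  by rewrite lerDr normsq_ge0.
pose C := invmx M *m (D *m Gam).
have MC : D *m Gam *m D *m C + lam *: C = D *m Gam.
  by rewrite -[lam *: C]mul1mx -scalemxAr scalemxAl -mulmxDl -/M mulKVmx.
have C0 i j : i \notin J -> C i j = 0.
  move=> iJ; have /matrixP/(_ i j) := MC.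
  rewrite -!mulmxA mxE !DE (negPf iJ) !mul0r add0r mxE => /eqP.
  by rewrite mulf_eq0 gt_eqF//= => /eqP.
have DC : D *m C = C.
  apply/matrixP => i j; rewrite DE; case: (boolP (i \in J)) => iJ.
    by rewrite mul1r.
  by rewrite C0// mulr0.
have CJ i j : i \in J -> (Gam *m (1%:M - C)) i j = lam * C i j.
  move=> iJ; have /matrixP/(_ i j) := MC.
  rewrite -!mulmxA DC [LHS]mxE !DE iJ !mul1r => h.
  have sub (A B : 'M[R]_N) : (A - B) i j = A i j - B i j by rewrite !mxE.
  have scal (A : 'M[R]_N) : (lam *: A) i j = lam * A i j by rewrite mxE.
  by rewrite mulmxBr mulmx1 sub -h scal; ring.
have colGam j : Gam j j = normsq (Psi *m delta_mx j (0 : 'I_1)).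
  rewrite GamE normsqE mxE; apply: eq_bigr => r _.
  by rewrite -colE !mxE expr2.
pose h j := delta_mx j (0 : 'I_1) - col j C.
have hE j : h j = col j (1%:M - C).
  by apply/matrixP => a b; rewrite !mxE ord1 eqxx andbT.
have Gh i j : (Gam *m h j) i 0 = (Gam *m (1%:M - C)) i j.
  by rewrite hE colE mulmxA -colE mxE.
have Gdot i j : (Gam *m (1%:M - C)) i j = dot (Psi *m delta_mx i 0) (Psi *m h j).
  rewrite dot_mull mulmxA -GamE -Gh dotE (bigD1 i)//= big1 ?addr0.
    by rewrite [X in _ = X * _]mxE !eqxx mul1r.
  by move=> a /negPf ai; rewrite [X in X * _]mxE ai mul0r.
have split j : Gam j j = normsq (Psi *m h j) + 2 * (lam * \sum_i C i j ^+ 2)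
    + normsq (Psi *m col j C).
  have -> : lam * \sum_i C i j ^+ 2 = dot (Psi *m h j) (Psi *m col j C).
    rewrite dotC dot_mull mulmxA -GamE dotE mulr_sumr; apply: eq_bigr => i _.
    rewrite [col j C i 0]mxE Gh; case: (boolP (i \in J)) => iJ; last first.
      by rewrite C0// expr0n mulr0 mul0r.
    by rewrite CJ//; ring.
  by rewrite colGam -normsqD -mulmxDr subrK.
exists C; split => // [j|i j].
  have := split j; have := normsq_ge0 (Psi *m h j); have := normsq_ge0 (Psi *m col j C).
  have : 0 <= lam * \sum_i C i j ^+ 2.
    by rewrite mulr_ge0 ?(ltW lam0)// sumr_ge0// => i _; rewrite sqr_ge0.
  lra.
rewrite Gdot; apply: le_trans (cauchy_schwarz _ _) _.
rewrite -colGam ler_wpM2l//; first by rewrite colGam normsq_ge0.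
have := split j; have := normsq_ge0 (Psi *m col j C).
have : 0 <= lam * \sum_i C i j ^+ 2.
  by rewrite mulr_ge0 ?(ltW lam0)// sumr_ge0// => a _; rewrite sqr_ge0.
lra.
Qed.

Lemma norm_le_sqr (R : realDomainType) (a b : R) : 0 <= b -> a ^+ 2 <= b ^+ 2 -> `|a| <= b.
Proof. by move=> b0 ab; rewrite -(@ler_pXn2r _ 2) ?nnegrE// real_normK ?num_real. Qed.

Lemma entry_bound (R : realFieldType) (L N : nat) (Phi : 'M[R]_(L, N)) (B b : R)
    (r : 'I_L) (z : 'cV[R]_N) : 0 <= B -> 0 <= b ->
  \sum_j Phi r j ^+ 2 <= B ^+ 2 -> normsq z <= b ^+ 2 -> `|(Phi *m z) r 0| <= B * b.
Proof.
move=> B0 b0 PB zb; apply: norm_le_sqr; first exact: mulr_ge0.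
have -> : (Phi *m z) r 0 = dot (row r Phi)^T z.
  by rewrite dotE mxE; apply: eq_bigr => j _; rewrite !mxE.
apply: le_trans (cauchy_schwarz _ _) _; rewrite exprMn.
apply: ler_pM => //; rewrite ?normsq_ge0//.
by rewrite normsqE; apply: le_trans PB; apply: ler_sum => j _; rewrite !mxE.
Qed.

(** * Column selection and its error *)

Section LowRank.
Variables (R : realFieldType) (L N : nat) (Phi : 'M[R]_(L, N)) (Om : {set 'I_L}).
Variables (Fi Fo : {set 'I_N}) (s c B th nu mu : R) (g o : 'I_N -> R).
Hypotheses (s_gt0 : 0 < s) (c_gt0 : 0 < c) (B_ge0 : 0 <= B) (mu_gt0 : 0 < mu)
  (th_ge0 : 0 <= th) (nu_ge0 : 0 <= nu) (g_ge0 : forall j, 0 <= g j)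
  (o_ge0 : forall j, 0 <= o j) (FiFo : [disjoint Fi & Fo]).
Hypotheses
  (riesz : forall z : 'cV[R]_N, s * c ^+ 2 * normsq z <= normsq (Phi *m z))
  (row_bound : forall r, \sum_j Phi r j ^+ 2 <= B ^+ 2)
  (g_bound : forall j, j \in Fi -> \sum_(r | r \notin Om) Phi r j ^+ 2 <= s * g j ^+ 2)
  (o_entry : forall j r, j \in Fo -> r \in Om -> `|Phi r j| <= o j)
  (o_bound : forall j, j \in Fo -> \sum_(r in Om) Phi r j ^+ 2 <= s * o j ^+ 2)
  (th_bound : mu + \sum_(j in Fi) g j ^+ 2 <= th ^+ 2)
  (nu_bound : mu^-1 <= nu ^+ 2).

Let Psi : 'M[R]_(L, N) := \matrix_(r, j) ((r \notin Om)%:R * Phi r j).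
Let Gi := invmx (Phi^T *m Phi).
Let Y := Phi *m Gi *m (Phi^T *m Psi).

Let k_gt0 : 0 < s * c ^+ 2. Proof. by rewrite mulr_gt0// exprn_gt0. Qed.

(** The mask is idempotent, so the middle factor of [Y] is a Gram matrix, as [ridge] requires. *)
Lemma mask_gram : Phi^T *m Psi = Psi^T *m Psi.
Proof.
apply/matrixP => i j; rewrite !mxE; apply: eq_bigr => r _; rewrite !mxE.
by case: (r \in Om); rewrite ?mul0r ?mulr0// !mul1r.
Qed.

Lemma mask_gram_diag j : j \in Fi -> (Phi^T *m Psi) j j <= s * g j ^+ 2.
Proof.
move=> jF; apply: le_trans (g_bound jF).
rewrite mask_gram mxE [leRHS]big_mkcond/= le_eqVlt; apply/orP; left; apply/eqP.
by apply: eq_bigr => r _; rewrite !mxE; case: (r \in Om); rewrite ?mul0r// !mul1r expr2.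
Qed.

(** Phi Gi Phi^T fixes the columns of Phi, so column j of Y is column j of Phi minus the projection
    of its part v inside [Om]. On [Om] both are small for j in [Fo]; the factors s cancel. *)
Lemma outer_bound j r : j \in Fo -> r \in Om -> `|Y r j| <= o j * (1 + B / c).
Proof.
move=> jF rO.
pose v : 'cV[R]_L := \col_q ((q \in Om)%:R * Phi q j).
have -> : Y r j = Phi r j - (Phi *m (Gi *m (Phi^T *m v))) r 0.
  have -> : Phi *m (Gi *m (Phi^T *m v)) = col j (Phi *m (Gi *m (Phi^T *m (Phi - Psi)))).
    rewrite colE -!mulmxA -colE; congr (_ *m (_ *m (_ *m _))).
    apply/matrixP => q b; rewrite !mxE; case: (q \in Om); rewrite ?mul0r ?mul1r ?subr0//.
    by rewrite subrr.
  have -> : Phi *m (Gi *m (Phi^T *m (Phi - Psi))) = Phi - Y.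
    rewrite mulmxBr (mulmxBr Gi) mulVmx; last exact: gram_unitmx k_gt0 riesz.
    by rewrite mulmxBr mulmx1 mulmxA.
  have cE (A : 'M[R]_(L, N)) : (col j A) r 0 = A r j by rewrite mxE.
  have sub (A C : 'M[R]_(L, N)) : (A - C) r j = A r j - C r j by rewrite !mxE.
  by rewrite cE sub opprB addrC subrK.
apply: le_trans (ler_normB _ _) _; rewrite mulrDr mulr1; apply: lerD; first exact: o_entry.
rewrite mulrCA; apply: entry_bound => //; first by rewrite divr_ge0// ltW.
have := gram_proj_bound k_gt0 riesz v; rewrite -/Gi.
have : normsq v <= s * o j ^+ 2.
  apply: le_trans (o_bound jF); rewrite normsqE [leRHS]big_mkcond/=.
  rewrite le_eqVlt; apply/orP; left; apply/eqP; apply: eq_bigr => q _; rewrite mxE.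
  by case: (q \in Om); rewrite ?mul0r ?expr0n ?mul1r.
set z := Gi *m _ => h1 h2; have := le_trans h2 h1.
by rewrite expr_div_n ler_pdivlMr ?exprn_gt0// -mulrA ler_pM2l// mulrC.
Qed.

(* [Fi] and [Fo] are the columns deep inside and far outside [Om]; s * mu is the
   ridge parameter. *)
Lemma low_rank_approx : exists M : 'M[R]_N,
  (\rank M <= #|~: (Fi :|: Fo)|)%N /\
  forall r, r \in Om -> \sum_j `|Y r j - (Y *m M) r j| <=
    (\sum_(j in Fi) g j) * (B * th / c ^+ 2 + (\sum_(j in Fo) o j) * (1 + B / c) * nu)
    + (\sum_(j in Fo) o j) * (1 + B / c).
Proof.
have lam0 : 0 < s * mu by exact: mulr_gt0.
(* The regression uses all columns off [Fi], those in [Fo] included, so that the residual is known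
   at every index off [Fi]; the [Fo] part of the combination is dropped in [dec]. *)
have [C [C0 CJ Cn Cw]] := ridge Psi (~: Fi) lam0.
rewrite -mask_gram in CJ Cn Cw.
set Gam := Phi^T *m Psi in CJ Cn Cw.
pose K := ~: (Fi :|: Fo).
(* Columns in K are kept, those in [Fi] are replaced by their regression, those in [Fo] by 0.
   Factoring through the coordinates in K bounds the rank. *)
pose m i j : R := if j \in K then (i == j)%:R else if j \in Fi then C i j else 0.
pose M : 'M[R]_N := (\matrix_(i, p) (i == enum_val p)%:R : 'M[R]_(N, #|K|)) *m
  (\matrix_(p, j) m (enum_val p) j).
have ME i j : M i j = if i \in K then m i j else 0.
  rewrite mxE; case: ifP => iK.
    rewrite (bigD1 (enum_rank_in iK i))//= !mxE enum_rankK_in// eqxx mul1r big1 ?addr0//.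
    move=> p; apply: contraNeq => h; apply/eqP/enum_val_inj.
    rewrite enum_rankK_in//; apply/esym/eqP; apply: contraNT h => /negPf ip.
    by rewrite !mxE ip mul0r.
  rewrite big1// => p _; rewrite !mxE; case: eqP => [ip|_]; last by rewrite mul0r.
  by move: iK; rewrite ip enum_valP.
exists M; split; first by rewrite (leq_trans (mxrankM_maxl _ _))// rank_leq_col.
move=> r rO.
have YM j : (Y *m M) r j = \sum_(i in K) Y r i * m i j.
  rewrite mxE [RHS]big_mkcond/=; apply: eq_bigr => i _.
  by rewrite ME; case: ifP; rewrite ?mulr0.
have SO0 : 0 <= \sum_(j in Fo) o j by exact: sumr_ge0.
have Bc0 : 0 <= 1 + B / c by rewrite addr_ge0// divr_ge0// ltW.
have errK j : j \in K -> `|Y r j - (Y *m M) r j| = 0.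
  move=> jK; apply/eqP; rewrite normr_eq0 subr_eq0 YM (bigD1 j)//= big1 ?addr0.
    by rewrite /m jK eqxx mulr1.
  by move=> i /andP[_ /negPf ij]; rewrite /m jK ij mulr0.
have errFo j : j \in Fo -> `|Y r j - (Y *m M) r j| <= o j * (1 + B / c).
  move=> jF; rewrite YM big1 ?subr0; first exact: outer_bound.
  move=> i _; rewrite /m.
  have -> : (j \in K) = false by rewrite !inE jF orbT.
  by rewrite (disjointFl FiFo jF) mulr0.
have errFi j : j \in Fi -> `|Y r j - (Y *m M) r j| <=
    g j * (B * th / c ^+ 2 + (\sum_(j in Fo) o j) * (1 + B / c) * nu).
  move=> jF.
  have Cle i : `|C i j| <= nu * g j.
    apply: norm_le_sqr; first exact: mulr_ge0.
    have : s * mu * C i j ^+ 2 <= s * g j ^+ 2.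
      apply: le_trans (mask_gram_diag jF); apply: le_trans (Cn j).
      rewrite ler_wpM2l ?(ltW lam0)// (bigD1 i)//= lerDl sumr_ge0// => l _.
      by rewrite sqr_ge0.
    rewrite -mulrA ler_pM2l// -ler_pdivlMl// exprMn => h; apply: le_trans h _.
    by rewrite ler_wpM2r ?sqr_ge0.
  pose w := col j (Gam *m (1%:M - C)).
  (* On [Fi] the residual is bounded by Cauchy-Schwarz, off [Fi] it equals s mu C; together they
     give (s g_j)^2 (mu + sum g^2). *)
  have wn : normsq w <= (s * g j * th) ^+ 2.
    rewrite normsqE (bigID [in Fi])/=.
    have d0 i : 0 <= Gam i i.
      by rewrite /Gam mask_gram mxE sumr_ge0// => q _; rewrite mxE -expr2 sqr_ge0.
    have h1 : \sum_(i in Fi) w i 0 ^+ 2 <= s * g j ^+ 2 * (s * \sum_(i in Fi) g i ^+ 2).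
      rewrite !mulr_sumr; apply: ler_sum => i iF; rewrite mxE.
      apply: le_trans (Cw i j) _; rewrite mulrC; apply: ler_pM => //; exact: mask_gram_diag.
    have h2 : \sum_(i | i \notin Fi) w i 0 ^+ 2 <= s * mu * (s * g j ^+ 2).
      have := ler_wpM2l (ltW lam0) (le_trans (Cn j) (mask_gram_diag jF)).
      apply: le_trans; rewrite mulrA -expr2 mulr_sumr [leRHS](bigID [in Fi])/= .
      have e : \sum_(i | i \notin Fi) w i 0 ^+ 2 =
          \sum_(i | i \notin Fi) (s * mu) ^+ 2 * C i j ^+ 2.
        by apply: eq_bigr => i iF; rewrite mxE CJ ?inE// exprMn.
      by rewrite e lerDr sumr_ge0// => i _; rewrite mulr_ge0 ?sqr_ge0.
    apply: le_trans (lerD h1 h2) _.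
    have -> : s * g j ^+ 2 * (s * \sum_(i in Fi) g i ^+ 2) + s * mu * (s * g j ^+ 2) =
      (s * g j) ^+ 2 * (mu + \sum_(i in Fi) g i ^+ 2) by ring.
    by rewrite [leRHS]exprMn ler_wpM2l ?sqr_ge0.
  have zn : normsq (Gi *m w) <= (g j * th / c ^+ 2) ^+ 2.
    have := le_trans (gram_inv_bound k_gt0 riesz w) wn; rewrite -/Gi => h.
    rewrite expr_div_n ler_pdivlMr ?exprn_gt0//.
    move: h; rewrite -(ler_pM2l (exprn_gt0 2 s_gt0) _ ((g j * th) ^+ 2)).
    have -> : s ^+ 2 * (normsq (Gi *m w) * (c ^+ 2) ^+ 2) = (s * c ^+ 2) ^+ 2 * normsq (Gi *m w).
      by ring.
    by have -> : s ^+ 2 * (g j * th) ^+ 2 = (s * g j * th) ^+ 2 by ring.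
  (* Y (e_j - C_j) = Phi Gi w, and restricting C_j to K adds back its terms in [Fo]. *)
  have dec : Y r j - (Y *m M) r j =
      (Phi *m (Gi *m w)) r 0 + \sum_(i in Fo) Y r i * C i j.
    have jK : (j \in K) = false by rewrite !inE jF.
    rewrite YM.
    have -> : \sum_(i in K) Y r i * m i j = \sum_(i in K) Y r i * C i j.
      by apply: eq_bigr => i _; rewrite /m jK jF.
    have -> : (Phi *m (Gi *m w)) r 0 = Y r j - (Y *m C) r j.
      rewrite /w colE !mulmxA -colE mxE -(mulmxA _ Phi^T) -/Gam -/Y mulmxBr mulmx1.
      by rewrite !mxE.
    rewrite -addrA; congr (_ + _).
    have -> : (Y *m C) r j = \sum_(i in K) Y r i * C i j + \sum_(i in Fo) Y r i * C i j.
      rewrite mxE (bigID [in K])/=; congr (_ + _).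
      rewrite [LHS]big_mkcond [RHS]big_mkcond; apply: eq_bigr => i _.
      rewrite !inE negbK; case: (boolP (i \in Fo)) => iFo; rewrite ?orbT// orbF.
      by case: (boolP (i \in Fi)) => // iFi; rewrite C0 ?mulr0// inE negbK.
    by rewrite opprD addrNK.
  rewrite dec; apply: le_trans (ler_normD _ _) _; rewrite mulrDr; apply: lerD.
    have -> : g j * (B * th / c ^+ 2) = B * (g j * th / c ^+ 2) by ring.
    by apply: entry_bound => //; apply: divr_ge0; [exact: mulr_ge0|exact: sqr_ge0].
  apply: le_trans (ler_norm_sum _ _ _) _.
  have -> : g j * ((\sum_(j in Fo) o j) * (1 + B / c) * nu) =
      \sum_(i in Fo) (o i * (1 + B / c)) * (nu * g j).
    by rewrite -!mulr_suml; ring.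
  apply: ler_sum => i iF; rewrite normrM; apply: ler_pM => //; exact: outer_bound.
rewrite (bigID [in K])/= big1 ?add0r => [|j jK]; last exact: errK.
rewrite (bigID [in Fi])/= [X in _ <= X + _]mulr_suml [X in _ <= _ + X]mulr_suml; apply: lerD.
  rewrite [leLHS]big_mkcond [leRHS]big_mkcond; apply: ler_sum => j _.
  rewrite /K !inE negbK; case: (boolP (j \in Fi)) => jF; rewrite ?andbF//=.
  exact: errFi.
rewrite [leLHS]big_mkcond [leRHS]big_mkcond; apply: ler_sum => j _.
rewrite /K !inE negbK; case: (boolP (j \in Fi)) => jF/=.
  by rewrite (disjointFr FiFo jF).
by case: (boolP (j \in Fo)) => // jFo; exact: errFo.
Qed.

End LowRank.

(** * The discrete Fourier transform and the pseudo-inverse *)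

Section Cis.
Local Open Scope complex_scope.
Local Open Scope sesquilinear_scope.
Variable R : realType.

Definition cis (t : R) : R[i] := cos t +i* sin t.

Lemma cisD t u : cis (t + u) = cis t * cis u.
Proof. by rewrite /cis cosD sinD; simpc; congr (_ +i* _); ring. Qed.

Lemma cis0 : cis 0 = 1.
Proof. by rewrite /cis cos0 sin0. Qed.

Lemma cisMn t n : cis (t * n%:R) = cis t ^+ n.
Proof.
elim: n => [|n IH]; first by rewrite mulr0 cis0.
by rewrite -natr1 mulrDr mulr1 cisD IH exprSr.
Qed.

Lemma cis_conj t : (cis t)^*%R = cis (- t).
Proof. by rewrite /cis cosN sinN. Qed.

Lemma cisZ_conj (a t : R) : (a%:C * cis t)^*%R = a%:C * cis (- t).
Proof.
by rewrite -cis_conj -[in RHS](conjc_real a); exact: rmorphM.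
Qed.

Lemma cis_2pi (n : int) : cis (2 * pi * n%:~R) = 1.
Proof.
have cis2 : cis (2 * pi) = 1 by rewrite /cis mulr_natl cos2pi sin2pi.
have cisn k : cis (2 * pi * k%:R) = 1 by rewrite cisMn cis2 expr1n.
case: n => k; first by rewrite -pmulrn.
rewrite NegzE mulrNz -pmulrn mulrN.
have := cisD (2 * pi * k.+1%:R) (- (2 * pi * k.+1%:R)).
by rewrite subrr cis0 cisn mul1r => <-.
Qed.

Lemma cis_neq1 t : 0 < t < 2 * pi -> cis t != 1.
Proof.
move=> /andP[t0 t2]; apply/eqP => -[c1 _].
have s0 : 0 < sin (t / 2).
  by apply: sin_gt0_pi; rewrite divr_gt0//= ltr_pdivrMr// mulrC.
have tE : t = (t / 2) *+ 2 by rewrite -mulr_natr divfK.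
move: c1; rewrite tE cos_mulr2n; have := cos2Dsin2 (t / 2).
move: (cos _) (sin _) s0 => c s s0; rewrite mulr2n => *; nra.
Qed.

Lemma sum_cis (N : nat) (d : int) : (0 < N)%N -> (0 < `|d| < N)%N ->
  \sum_(l < N) cis (2 * pi * d%:~R / N%:R * l%:R) = 0.
Proof.
move=> N0 /andP[d0 dN].
have N0' : 0 < N%:R :> R by rewrite ltr0n.
under eq_bigr do rewrite cisMn.
set z := cis _.
have zN : z ^+ N = 1 by rewrite /z -cisMn divfK ?gt_eqF// cis_2pi.
have z1 : z != 1.
  have pos (m : nat) : (0 < m < N)%N -> cis (2 * pi * m%:R / N%:R) != 1.
    move=> /andP[m0 mN]; apply: cis_neq1; apply/andP; split.
      by rewrite divr_gt0// mulr_gt0 ?ltr0n// mulr_gt0// pi_gt0.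
    by rewrite ltr_pdivrMr// ltr_pM2l ?ltr_nat// mulr_gt0// pi_gt0.
  rewrite /z; case: d d0 dN {z zN} => m m0 mN.
    by rewrite -pmulrn; apply: pos; rewrite m0.
  rewrite NegzE mulrNz -pmulrn mulrN mulNr -cis_conj.
  apply/eqP => h; have := pos m.+1 mN.
  have : ((cis (2 * pi * m.+1%:R / N%:R))^*%R)^*%R = (1 : R[i])^*%R by rewrite h.
  by rewrite conjCK conjC1 => ->; rewrite eqxx.
have := subrX1 z N; rewrite zN subrr => /esym/eqP.
by rewrite mulf_eq0 subr_eq0 (negPf z1) => /eqP.
Qed.

Lemma dft_unitary (N : nat) : (0 < N)%N -> dft R N *m (dft R N)^t* = 1%:M.
Proof.
move=> N0; apply/matrixP => k l; rewrite !mxE.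
have N0' : 0 < N%:R :> R by rewrite ltr0n.
pose r : R[i] := ((Num.sqrt N%:R)^-1)%:C.
have rr : r * r = (N%:R^-1)%:C.
  by rewrite /r -rmorphM -invfM -expr2 sqr_sqrtr// ltW.
have -> : \sum_j dft R N k j * (dft R N)^t* j l =
    r * r * \sum_(j < N) cis (2 * pi * (k%:Z - l%:Z)%:~R / N%:R * j%:R).
  rewrite mulr_sumr; apply: eq_bigr => j _; rewrite !mxE -/r.
  rewrite -/(cis (2 * pi * (k * j)%:R / N%:R)) -/(cis (2 * pi * (l * j)%:R / N%:R)).
  rewrite /r cisZ_conj -/r mulrACA -cisD; congr (_ * cis _).
  by rewrite intrB !natrM -!pmulrn; field; rewrite gt_eqF.
have [<-|kl] := eqVneq k l.
  rewrite subrr mulr0z; under eq_bigr do rewrite mulr0 !mul0r cis0.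
  rewrite sumr_const card_ord rr.
  have -> : (1 : R[i]) *+ N = (N%:R : R)%:C by rewrite rmorph_nat.
  by rewrite -rmorphM mulVf ?gt_eqF.
rewrite sum_cis ?mulr0//; have := ltn_ord k; have := ltn_ord l.
have : k != l :> nat by []. 
lia.
Qed.

End Cis.

(** * Elimination of the Fourier transform *)

Section Reduction.
Local Open Scope complex_scope.
Local Open Scope sesquilinear_scope.
Variables (R : realType) (T tau0 : R) (N s : nat).
Hypothesis N_gt0 : (0 < N)%N.

Let Phi : 'M[R]_(s * N, N) := Pimx R N s *m Ac T tau0 N s.
Let F := dft R N.
Let P := Pmx R N s.
Hypothesis uG : Phi^T *m Phi \in unitmx.
Let Gi := invmx (Phi^T *m Phi).

Let toCM (m n k : nat) (X : 'M[R]_(m, n)) (Y : 'M[R]_(n, k)) :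
  toC (X *m Y) = toC X *m toC Y.
Proof. by rewrite /toC map_mxM. Qed.

Let toCt (m n : nat) (X : 'M[R]_(m, n)) : (toC X)^t* = toC X^T.
Proof. by apply/matrixP => i j; rewrite !mxE; exact: conjc_real. Qed.

Let toC1 (m : nat) : toC (1%:M : 'M[R]_m) = 1%:M.
Proof. by rewrite /toC map_mx1. Qed.

Let FF : F *m F^t* = 1%:M. Proof. exact: dft_unitary. Qed.
Let FF' : F^t* *m F = 1%:M. Proof. exact: mulmx1C FF. Qed.

Let PP : P^t* *m P = 1%:M.
Proof.
rewrite /P /Pmx trmx_tens map_mxT tensmx_mul trmx1 map_mx1 mulmx1 trmxCK -/F FF.
apply/matrixP => i j; case: (mxtens_indexP i) => a b; case: (mxtens_indexP j) => c d.
by rewrite tensmxE !mxE (can_eq (@mxtens_indexK s N)) -natrM mulnb xpair_eqE.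
Qed.

(** B = P Phi F with P and F unitary and Phi of full column rank. The candidate is a left inverse of
    B, and B times it is a conjugated orthogonal projection, hence Hermitian. *)
Lemma pinv_Bmx : Defs.pinv (Bmx T tau0 N s) = F^t* *m toC (Gi *m Phi^T) *m P^t*.
Proof.
have GiT : Gi^T = Gi by rewrite /Gi trmx_inv trmx_mul trmxK.
have GG : Gi *m Phi^T *m Phi = 1%:M by rewrite -mulmxA mulVmx.
apply: Defs.pinv_unique.
have -> : Bmx T tau0 N s = P *m toC Phi *m F by [].
have BX : P *m toC Phi *m F *m (F^t* *m toC (Gi *m Phi^T) *m P^t*) =
    P *m toC (Phi *m Gi *m Phi^T) *m P^t*.
  rewrite -!mulmxA (mulmxA F) FF mul1mx !mulmxA -(mulmxA P) -toCM.
  by rewrite !mulmxA.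
have XB : F^t* *m toC (Gi *m Phi^T) *m P^t* *m (P *m toC Phi *m F) = 1%:M.
  rewrite -!mulmxA (mulmxA (P^t*)) PP mul1mx (mulmxA (toC _) (toC _)) -toCM GG toC1.
  by rewrite mul1mx FF'.
split.
- by rewrite -mulmxA XB mulmx1.
- by rewrite XB mul1mx.
- have HT : (Phi *m Gi *m Phi^T)^T = Phi *m Gi *m Phi^T.
    by rewrite (trmx_mul (Phi *m Gi)) (trmx_mul Phi) trmxK GiT mulmxA.
  by rewrite BX (trmxC_mul (P *m _)) (trmxC_mul P) trmxCK toCt HT mulmxA.
- by rewrite XB trmx1 map_mx1.
Qed.

Definition outer_part : 'M[R]_(s * N, N) :=
  \matrix_(r, j) ((r \notin colloc T N s)%:R * Phi r j).

Lemma restr_extE (A : 'M[R]_(s * N, N)) r j :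
  (ext T N s *m restr T N s *m A) r j = (r \in colloc T N s)%:R * A r j.
Proof.
rewrite -mulmxA mxE.
have RA p : (restr T N s *m A) p j = A (enum_val p) j.
  rewrite mxE (bigD1 (enum_val p))//= big1 ?addr0 => [|q /negPf qp].
    by rewrite mxE eqxx mul1r.
  by rewrite mxE qp mul0r.
under eq_bigr do rewrite RA !mxE.
case: (boolP (r \in _)) => rO; last first.
  rewrite mul0r big1// => p _; case: eqP => [rp|_]; last by rewrite mul0r.
  by move: rO; rewrite rp enum_valP.
rewrite mul1r (bigD1 (enum_rank_in rO r))//= enum_rankK_in// eqxx mul1r big1 ?addr0//.
move=> p; apply: contraNeq => h; apply/eqP/enum_val_inj.
rewrite enum_rankK_in//; apply/esym/eqP; apply: contraNT h => /negPf ip.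
by rewrite ip mul0r.
Qed.

(** By [pinv_Bmx], Z^* = Gi Phi^T E. Masking by E R turns Phi into Phi minus [outer_part], and the
    contribution of the full Phi is R Phi = A, which cancels. *)
Lemma AZresE : AZres T tau0 N s =
  toC (restr T N s *m (Phi *m Gi *m (Phi^T *m outer_part))).
Proof.
have -> : outer_part = Phi - ext T N s *m restr T N s *m Phi.
  apply/matrixP => r j.
  have -> (A B : 'M[R]_(s * N, N)) : (A - B) r j = A r j - B r j by rewrite !mxE.
  rewrite restr_extE [LHS]mxE.
  by case: (r \in _); rewrite ?mul0r ?mul1r ?subrr ?subr0.
have Z : Zstar T tau0 N s = toC (Gi *m Phi^T *m ext T N s).
  rewrite /Zstar pinv_Bmx -/F -/P !mulmxA FF mul1mx -(mulmxA _ (P^t*)) PP mulmx1.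
  by rewrite -toCM.
have AE : Amx T tau0 N s = restr T N s *m Phi by [].
rewrite /AZres Z -!toCM AE.
have -> (X Y : 'M[R]_(npts T N s, N)) : toC X - toC Y = toC (X - Y).
  by rewrite /toC map_mxB.
congr toC; rewrite mulmxBr mulmxBr -(mulmxA Phi Gi) mulVmx// mulmx1 mulmxBr.
by rewrite !mulmxA.
Qed.

End Reduction.

(** * Estimates for the collocation matrix *)

Lemma sum_sqr_le (R : realDomainType) (I : finType) (f : I -> R) :
  (forall i, 0 <= f i) -> \sum_i f i ^+ 2 <= (\sum_i f i) ^+ 2.
Proof.
move=> f0; rewrite [leRHS]expr2 mulr_suml; apply: ler_sum => i _.
by rewrite expr2 ler_wpM2l// (bigD1 i)//= lerDl sumr_ge0.
Qed.

(** Such j are counted by j - floor a - 1, a natural number below b - a. *)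
Lemma card_between (R : realType) (N : nat) (a b : R) : a <= b ->
  #|[set j : 'I_N | a < j%:R < b]|%:R <= b - a + 1.
Proof.
move=> ab; pose m := Num.floor a.
have [mlo mhi] : m%:~R <= a /\ a < m%:~R + 1.
  by have := floor_le_tmp a; have := floorD1_gt a; rewrite intrD.
pose d := (Num.truncn (b - a)).+1.
suff : (#|[set j : 'I_N | (a < j%:R < b)%R]| <= d)%N.
  rewrite -(ler_nat R) => h; apply: le_trans h _; rewrite /d -natr1 lerD2r.
  by rewrite truncn_le// subr_ge0.
rewrite -[leqRHS](size_iota 0) cardE -(size_map (fun j : 'I_N => `|(j%:Z - m - 1)%R|%N)).
have key (j : 'I_N) : a < j%:R < b -> (0 <= j%:Z - m - 1) /\ (j%:Z - m - 1)%:~R < b - a.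
  move=> /andP[aj jb].
  have mj : m < j%:Z.
    by rewrite -(ltr_int R); apply: le_lt_trans mlo _; rewrite -pmulrn.
  split; first by lia.
  by rewrite !intrB -pmulrn; lra.
apply: uniq_leq_size.
  rewrite map_inj_in_uniq ?enum_uniq// => j k; rewrite !mem_enum !inE.
  move=> /key[j0 _] /key[k0 _] jk; apply: val_inj => /=; lia.
move=> _ /mapP[j + ->]; rewrite mem_enum inE => /key[j0 jb].
rewrite mem_iota/= add0n /d ltnS.
rewrite truncn_ge_nat ?subr_ge0// ltW//; apply: le_lt_trans jb.
by rewrite -[X in X <= _]/((Posz `|(j%:Z - m - 1)%R|%N)%:~R) gez0_abs.
Qed.

Lemma sum_tens (R : nmodType) (s N : nat) (f : 'I_(s * N) -> R) :
  \sum_r f r = \sum_(k < s) \sum_(i < N) f (mxtens_index (k, i)).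
Proof.
rewrite pair_big/= (reindex (@mxtens_index s N))/=; last first.
  by exists (@mxtens_unindex s N) => x _; rewrite ?mxtens_indexK ?mxtens_unindexK.
by apply: eq_bigr => -[].
Qed.

Section Estimates.
Variables (R : realType) (T tau0 : R) (N s : nat).
Hypotheses (T_gt1 : 1 < T) (tau0_gt0 : 0 < tau0) (N_gt0 : (0 < N)%N) (s_gt0 : (0 < s)%N).

Let al := alpha tau0.
Let al_gt0 : 0 < al. Proof. exact: alpha_gt0. Qed.
Let T_gt0 : 0 < T. Proof. exact: lt_trans T_gt1. Qed.
Let NR_gt0 : 0 < N%:R :> R. Proof. by rewrite ltr0n. Qed.
Let sR_gt0 : 0 < s%:R :> R. Proof. by rewrite ltr0n. Qed.

(** The position of the permuted row r = k N + i, measured from -T in units of 2T/N: block k is the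
    lattice of centers shifted by k/s. *)
Definition grid_pos (r : 'I_(s * N)) : R := (r %/ N)%:R / s%:R + (r %% N)%:R.

Let Phi : 'M[R]_(s * N, N) := Pimx R N s *m Ac T tau0 N s.

Lemma grid_reorder (r : 'I_(s * N)) :
  grid T (reorder r) = 2 * T / N%:R * (grid_pos r - N%:R / 2).
Proof.
rewrite /grid /grid_pos /= natrD !natrM; field.
by rewrite !gt_eqF.
Qed.

Lemma PhiE (r : 'I_(s * N)) (j : 'I_N) : Phi r j = gper al N (grid_pos r - j%:R).
Proof.
rewrite /Phi -row_permE mxE permE mxE /basis grid_reorder.
rewrite -(@gauss_per_gper _ T)//; congr (gauss_per _ _ _); rewrite /Defs.center; field.
by rewrite gt_eqF.
Qed.

Lemma Phi_ge0 r j : 0 <= Phi r j.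
Proof. by rewrite PhiE gper_ge0. Qed.

Lemma grid_pos_tens (k : 'I_s) (i : 'I_N) :
  grid_pos (mxtens_index (k, i)) = k%:R / s%:R + i%:R.
Proof.
have /(congr1 val) h1 := congr1 fst (mxtens_indexK (k, i)).
have /(congr1 val) h2 := congr1 snd (mxtens_indexK (k, i)).
by rewrite /grid_pos; congr (_%:R / _ + _%:R).
Qed.

Lemma Phi_row_bound r : \sum_j Phi r j ^+ 2 <= gbound al ^+ 2.
Proof.
apply: le_trans (sum_sqr_le _) _ => [j|]; first exact: Phi_ge0.
rewrite ler_pXn2r ?nnegrE ?sumr_ge0//.
- rewrite (eq_bigr (fun j : 'I_N => gper al N (grid_pos r + (- j%:Z)%:~R))); last first.
    by move=> j _; rewrite PhiE mulrNz.
  apply: sum_gper_bound => // i j /eqP; rewrite eqz_mod_dvd => /dvdzP[q qE].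
  by apply/esym/(@ord_eq_mod _ _ _ q); lia.
- by move=> j _; exact: Phi_ge0.
- by have := @gauss_int_sum R al 0 [::] al_gt0 isT; rewrite big_nil.
Qed.

(** These are the blocks with offset at most 1/4, to which [gper_riesz] applies; k = 0 makes up for
    the rounding of s/4. *)
Lemma card_quarter : s%:R / 4 <= \sum_(k < s | (4 * k <= s)%N) 1 :> R.
Proof.
have le_s : ((s %/ 4).+1 <= s)%N by lia.
rewrite -(big_mkord (fun k => (4 * k <= s)%N) (fun=> 1)).
have -> : \sum_(0 <= k < s | (4 * k <= s)%N) 1 = \sum_(0 <= k < (s %/ 4).+1) (1 : R).
  by rewrite [RHS](big_nat_widen _ _ s)//; apply: eq_bigl => k /=; lia.
rewrite big_const_nat subn0 iter_addr_0 ler_pdivrMr// -natrM ler_nat; lia.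
Qed.

(** Block k of Phi is the periodic convolution with offset k/s. The blocks with offset at most 1/4
    suffice, and the others contribute nonnegative terms. *)
Lemma Phi_riesz (z : 'cV[R]_N) :
  s%:R * (theta_low al / 4) ^+ 2 * normsq z <= normsq (Phi *m z).
Proof.
have modN (n : int) : (`|(n %% N)%Z|%N < N)%N by lia.
pose Z (n : int) : R := z (Ordinal (modN n)) 0.
have pZ : periodic N Z.
  move=> n; congr (z _ 0); apply: val_inj => /=.
  by rewrite -[n - _]addrC -[in X in X + n]mulN1r modzMDl.
have Zj (j : 'I_N) : Z j%:Z = z j 0.
  congr (z _ 0); apply: val_inj => /=; have := ltn_ord j => jN.
  by rewrite modz_small; lia.
have nZ : pnormsq N Z = normsq z by rewrite normsqE; apply: eq_bigr => j _; rewrite Zj.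
rewrite [leRHS]normsqE sum_tens.
have th0 : 0 <= theta_low al ^+ 2 / 4 * normsq z.
  by rewrite mulr_ge0 ?normsq_ge0// divr_ge0 ?sqr_ge0.
apply: le_trans (_ : (\sum_(k < s | (4 * k <= s)%N) 1) * (theta_low al ^+ 2 / 4 * normsq z) <= _).
  have -> : s%:R * (theta_low al / 4) ^+ 2 * normsq z =
      s%:R / 4 * (theta_low al ^+ 2 / 4 * normsq z) by field.
  by rewrite ler_wpM2r// card_quarter.
rewrite mulr_suml [leLHS]big_mkcond/=; apply: ler_sum => k _.
case: ifP => k4; last by apply: sumr_ge0 => i _; rewrite sqr_ge0.
have x0 : 0 <= k%:R / s%:R :> R by rewrite divr_ge0.
have x1 : k%:R / s%:R <= 4^-1 :> R.
  by rewrite ler_pdivrMr// mulrC ler_pdivlMr// -natrM ler_nat mulnC.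
rewrite mul1r -nZ; apply: le_trans (gper_riesz al_gt0 x0 x1 N_gt0 pZ) _.
rewrite le_eqVlt; apply/orP; left; apply/eqP; apply: eq_bigr => i _; congr (_ ^+ 2).
rewrite mxE; apply: eq_bigr => j _; rewrite Zj PhiE grid_pos_tens.
by rewrite intrB addrA -!pmulrn.
Qed.

Let H : R := N%:R / (2 * T).

(* Signed distance of a center to the boundary of [-1, 1] in units of 2T/N,
   positive inside. *)
Definition depth (j : 'I_N) : R := N%:R / (2 * T) - `|j%:R - N%:R / 2|.

Lemma H_lt : 0 < H < N%:R / 2.
Proof.
rewrite /H divr_gt0//=; last by rewrite mulr_gt0.
by rewrite ltr_pdivrMr ?mulr_gt0// mulrA divfK// ltr_pMr.
Qed.

Lemma mem_colloc r : (r \in colloc T N s) = (`|grid_pos r - N%:R / 2| <= H).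
Proof.
rewrite inE grid_reorder -ler_norml normrM gtr0_norm; last first.
  by rewrite divr_gt0// mulr_gt0.
rewrite -ler_pdivlMl ?divr_gt0// ?mulr_gt0// mulr1 invf_div //.
Qed.

Lemma grid_pos_range r : 0 <= grid_pos r < N%:R.
Proof.
case: (mxtens_indexP r) => k i; rewrite grid_pos_tens.
have ks : k%:R / s%:R < 1 :> R by rewrite ltr_pdivrMr// mul1r ltr_nat.
have iN : i%:R + 1 <= N%:R :> R by rewrite natr1 ler_nat.
by rewrite addr_ge0//=; lra.
Qed.

Lemma far_away (m : int) (x M : R) : `|x| <= M / 2 -> `|x| <= `|x - m%:~R * M|.
Proof.
move=> xM; have M0 : 0 <= M by have := normr_ge0 x; lra.
have [->|m0] := eqVneq m 0; first by rewrite mul0r subr0.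
have m1 : 1 <= `|m%:~R| :> R.
  by rewrite -intr_norm -[leLHS]/(1%:~R) ler_int; lia.
have := lerB_dist (m%:~R * M) x; rewrite [`|_ * M - x|]distrC normrM (ger0_norm M0).
by have := ler_wpM2r M0 m1; lra.
Qed.

(** Row and center lie on opposite sides of the boundary of [-1, 1]. The period shift is moved to
    whichever of them is outside: by [far_away] no shift brings it closer to the midpoint. *)
Lemma depth_dist (r : 'I_(s * N)) (j : 'I_N) (m : int) :
  (r \notin colloc T N s) && (0 <= depth j) || (r \in colloc T N s) && (depth j <= 0) ->
  `|depth j| <= `|grid_pos r - j%:R - m%:~R * N%:R|.
Proof.
have /andP[H0 H2] := H_lt; have /andP[u0 uN] := grid_pos_range r.
pose U := grid_pos r - N%:R / 2; pose V : R := j%:R - N%:R / 2.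
have -> : grid_pos r - j%:R - m%:~R * N%:R = U - V - m%:~R * N%:R by rewrite /U /V; ring.
have U2 : `|U| <= N%:R / 2 by rewrite ler_norml /U; lra.
have V2 : `|V| <= N%:R / 2.
  have jN : j%:R <= N%:R :> R by rewrite ler_nat ltnW.
  have j0 : 0 <= j%:R :> R by [].
  by rewrite ler_norml /V; lra.
rewrite mem_colloc -/U -ltNge /depth -/H -/V => /orP[/andP[HU dj]|/andP[HU dj]].
  rewrite ger0_norm//; have := far_away m U2.
  have -> : U - V - m%:~R * N%:R = (U - m%:~R * N%:R) - V by ring.
  have := lerB_dist (U - m%:~R * N%:R) V; lra.
rewrite ler0_norm//; have := far_away (- m) V2; rewrite mulrNz mulNr opprK.
have -> : U - V - m%:~R * N%:R = U - (V + m%:~R * N%:R) by ring.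
have := lerB_dist (V + m%:~R * N%:R) U; rewrite distrC; lra.
Qed.

(* A twentieth of the exponent is set aside to sum over the grid points. *)
Definition weight (j : 'I_N) : R :=
  gbound (al / 20) * expR (- (19 / 20 * al * depth j ^+ 2)).

Lemma gbound_ge0 (b : R) : 0 < b -> 0 <= gbound b.
Proof. by move=> b0; have := @gauss_int_sum R b 0 [::] b0 isT; rewrite big_nil. Qed.

Lemma Phi_decay (r : 'I_(s * N)) (j : 'I_N) :
  (r \notin colloc T N s) && (0 <= depth j) || (r \in colloc T N s) && (depth j <= 0) ->
  Phi r j <= expR (- (19 / 20 * al * depth j ^+ 2)) * gper (al / 20) N (grid_pos r - j%:R).
Proof.
move=> rj; rewrite PhiE.
have c01 : 0 < (20^-1 : R) < 1 by rewrite invr_gt0 ltr0n invf_lt1// ltr1n.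
have := gper_decay al_gt0 N_gt0 (normr_ge0 (depth j)) c01 (fun m => depth_dist m rj).
rewrite real_normK ?num_real// [20^-1 * al]mulrC.
by have -> : (1 - 20^-1) * al = 19 / 20 * al by field.
Qed.

Let al20_gt0 : 0 < al / 20. Proof. by rewrite divr_gt0. Qed.

Lemma Phi_entry_weight r j :
  (r \notin colloc T N s) && (0 <= depth j) || (r \in colloc T N s) && (depth j <= 0) ->
  Phi r j <= weight j.
Proof.
move=> /Phi_decay h; apply: le_trans h _; rewrite /weight mulrC ler_wpM2r ?expR_ge0//.
apply: fine_esum_le => [m|t ut]; first exact: expR_ge0.
exact: gper_terms_le.
Qed.

(** In each of the s blocks the sum of squares is at most the square of the sum, which
    [sum_gper_bound] controls. *)
Lemma Phi_col_weight (P : pred 'I_(s * N)) j :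
  (forall r, P r ->
    (r \notin colloc T N s) && (0 <= depth j) || (r \in colloc T N s) && (depth j <= 0)) ->
  \sum_(r | P r) Phi r j ^+ 2 <= s%:R * weight j ^+ 2.
Proof.
move=> Pr; set E := expR (- (19 / 20 * al * depth j ^+ 2)).
pose f r := (E * gper (al / 20) N (grid_pos r - j%:R)) ^+ 2.
have f0 r : 0 <= E * gper (al / 20) N (grid_pos r - j%:R).
  by rewrite mulr_ge0 ?expR_ge0 ?gper_ge0.
apply: (@le_trans _ _ (\sum_r f r)).
  rewrite big_mkcond/=; apply: ler_sum => r _; case: ifP => [/Pr rj|_]; last exact: sqr_ge0.
  by rewrite ler_pXn2r ?nnegrE ?Phi_ge0// Phi_decay.
have -> : s%:R * weight j ^+ 2 = \sum_(k < s) weight j ^+ 2.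
  by rewrite sumr_const card_ord mulr_natl.
rewrite sum_tens; apply: ler_sum => k _.
apply: le_trans (@sum_sqr_le _ _ (fun i : 'I_N =>
  E * gper (al / 20) N (grid_pos (mxtens_index (k, i)) - j%:R)) (fun=> f0 _)) _.
rewrite -mulr_sumr /weight mulrC ler_pXn2r ?nnegrE//; last 2 first.
- by rewrite mulr_ge0 ?expR_ge0// sumr_ge0// => i _; rewrite gper_ge0.
- by rewrite mulr_ge0 ?expR_ge0// gbound_ge0.
rewrite ler_wpM2r ?expR_ge0//.
rewrite (eq_bigr (fun i : 'I_N =>
    gper (al / 20) N (k%:R / s%:R + (i%:Z - j%:Z)%:~R))); last first.
  by move=> i _; rewrite grid_pos_tens intrB addrA -!pmulrn.
apply: sum_gper_bound => // i i' /eqP; rewrite eqz_mod_dvd => /dvdzP[q qE].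
by apply: (@ord_eq_mod _ _ _ q); lia.
Qed.

(** Up to sign, [depth j] is the distance of j to one of the endpoints N/2 + H and N/2 - H, so two
    shifted Gaussian sums dominate. *)
Lemma sum_gauss_depth (b : R) : 0 < b ->
  \sum_(j < N) expR (- (b * depth j ^+ 2)) <= 2 * gbound b.
Proof.
move=> b0.
have line (y : R) : \sum_(j < N) expR (- (b * (j%:R - y) ^+ 2)) <= gbound b.
  have us : uniq [seq (nat_of_ord j)%:Z | j : 'I_N <- index_enum 'I_N].
    by rewrite map_inj_uniq ?index_enum_uniq// => i j [] /val_inj.
  have := gauss_int_sum y b0 us; rewrite big_map.
  by under eq_bigr do rewrite -pmulrn.
have := lerD (line (N%:R / 2 + H)) (line (N%:R / 2 - H)).
have -> : gbound b + gbound b = 2 * gbound b by ring.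
rewrite -big_split/= => h; apply: le_trans h.
apply: ler_sum => j _; rewrite /depth -/H.
case: (ger0P (j%:R - N%:R / 2)) => _.
  have -> : (H - (j%:R - N%:R / 2)) ^+ 2 = (j%:R - (N%:R / 2 + H)) ^+ 2 by ring.
  by rewrite lerDl expR_ge0.
have -> : (H - - (j%:R - N%:R / 2)) ^+ 2 = (j%:R - (N%:R / 2 - H)) ^+ 2 by ring.
by rewrite lerDr expR_ge0.
Qed.

(** Of the exponent 19/20, the share 9/10 is estimated at depth t and the remaining 1/20 is summed
    over the centers. *)
Lemma sum_weight (P : pred 'I_N) (t : R) : 0 <= t ->
  (forall j, P j -> t <= `|depth j|) ->
  \sum_(j | P j) weight j <=
    2 * gbound (al / 20) ^+ 2 * expR (- (9 / 10 * al * t ^+ 2)).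
Proof.
move=> t0 Pt; set G := gbound _; have G0 : 0 <= G by exact: gbound_ge0.
apply: (@le_trans _ _ (\sum_(j < N) G * expR (- (9 / 10 * al * t ^+ 2)) *
    expR (- (al / 20 * depth j ^+ 2)))).
  rewrite big_mkcond/=; apply: ler_sum => j _; case: ifP => [Pj|_]; last first.
    by apply: mulr_ge0; [apply: mulr_ge0 => //|]; exact: expR_ge0.
  rewrite /weight -/G -[leRHS]mulrA ler_wpM2l// -expRD ler_expR.
  have : t ^+ 2 <= depth j ^+ 2.
    by rewrite -[leRHS]real_normK ?num_real// ler_pXn2r ?nnegrE// Pt.
  move: (depth j ^+ 2) (t ^+ 2) => a b ab.
  have : 0 <= al * (a - b) by rewrite mulr_ge0 ?subr_ge0// ltW.
  lra.
rewrite -mulr_sumr.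
have -> : 2 * G ^+ 2 * expR (- (9 / 10 * al * t ^+ 2)) =
  G * expR (- (9 / 10 * al * t ^+ 2)) * (2 * G) by ring.
by apply: ler_wpM2l (sum_gauss_depth al20_gt0); apply: mulr_ge0 => //; exact: expR_ge0.
Qed.

Lemma card_strip (t0 r0 : R) : 0 <= t0 -> 0 <= r0 ->
  #|[set j : 'I_N | - r0 < depth j < t0]|%:R <= 2 * (t0 + r0 + 1).
Proof.
move=> t00 r00; pose S (a b : R) := [set j : 'I_N | a < j%:R < b].
have sub : [set j : 'I_N | - r0 < depth j < t0] \subset
    S (N%:R / 2 + H - t0) (N%:R / 2 + H + r0) :|: S (N%:R / 2 - H - r0) (N%:R / 2 - H + t0).
  apply/fintype.subsetP => j; rewrite !inE /depth -/H => /andP[].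
  case: (ger0P (j%:R - N%:R / 2)) => _ h1 h2; apply/orP; [left|right]; lra.
have h1 := @card_between R N (N%:R / 2 + H - t0) (N%:R / 2 + H + r0).
have h2 := @card_between R N (N%:R / 2 - H - r0) (N%:R / 2 - H + t0).
have := leq_trans (subset_leq_card sub) (leq_card_setU _ _).
rewrite -(ler_nat R) natrD => h; apply: le_trans h _.
apply: le_trans (lerD (h1 _) (h2 _)) _; lra.
Qed.

End Estimates.

(** * The low-rank approximation *)

Local Open Scope complex_scope.

Lemma normc_real (R : realType) (x : R) : ComplexField.Normc.normc x%:C = `|x|.
Proof. by rewrite /= expr0n/= addr0 sqrtr_sqr. Qed.

Lemma halfwidth_sqr (R : realType) (tau0 delta : R) : 0 < tau0 -> 0 < delta < 1 ->
  expR (- (alpha tau0 * halfwidth tau0 delta ^+ 2)) = delta.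
Proof.
move=> t0 /andP[d0 d1]; have l0 := ln1V_gt0 t0.
have ld : ln delta < 0 by rewrite ln_lt0// d0.
rewrite /halfwidth exprMn sqr_sqrtr; last by nra.
have p0 : pi != 0 :> R by rewrite gt_eqF ?pi_gt0.
have -> : alpha tau0 * (pi^-1 ^+ 2 * (- 2 * ln delta * ln (1 + tau0 ^- 2))) = - ln delta.
  rewrite /alpha; move: (pi : R) p0 => q q0; field.
  by rewrite q0 gt_eqF.
by rewrite opprK lnK.
Qed.

(** * Choice of the constants *)

Section Constants.
Variables (R : realType) (tau0 : R).
Hypothesis tau0_gt0 : 0 < tau0.
Let al := alpha tau0.
Let c := theta_low al / 4.
Let B := gbound al.
Let G := 2 * gbound (al / 20) ^+ 2.

(** The bound of [low_rank_approx] for the parameters of [outer_low_rank], with all exponentials in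
    W removed. *)
Definition error_constant : R :=
  G * (B * (1 + G) / c ^+ 2 + G * (1 + B / c)) + G * (1 + B / c).

(** For delta = exp (- al W^2) below this value, al W^2 > 100 al + 15 [error_constant]. The first
    term forces W >= 10, the second [error_constant] <= 7/100 al W^2, as 100/7 < 15. *)
Definition delta_max : R := expR (- (100 * al + 15 * error_constant)).

Let al_gt0 : 0 < al. Proof. exact: alpha_gt0. Qed.
Let c_gt0 : 0 < c.
Proof. by rewrite divr_gt0// /theta_low mulr_gt0 ?exprn_gt0 ?mulr_gt0 ?expR_gt0. Qed.
Let B_ge0 : 0 <= B. Proof. exact: gbound_ge0. Qed.
Let G_ge0 : 0 <= G. Proof. by rewrite mulr_ge0// sqr_ge0. Qed.
Let Bc_ge0 : 0 <= 1 + B / c. Proof. by rewrite addr_ge0// divr_ge0// ltW. Qed.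
Let BG_ge0 : 0 <= B * (1 + G) / c ^+ 2.
Proof. by rewrite divr_ge0 ?sqr_ge0// mulr_ge0// addr_ge0. Qed.

Lemma error_constant_ge0 : 0 <= error_constant.
Proof.
have GB : 0 <= G * (1 + B / c) by exact: mulr_ge0.
by apply: addr_ge0 => //; apply: mulr_ge0 => //; exact: addr_ge0.
Qed.

Lemma delta_max_width (delta : R) : 0 < delta < delta_max ->
  let W := halfwidth tau0 delta in
  [/\ 10 <= W, expR (- (al * W ^+ 2)) = delta & error_constant <= 7 / 100 * (al * W ^+ 2)].
Proof.
move=> /andP[d0 dm] W; have K0 := error_constant_ge0.
have m1 : delta_max <= 1.
  rewrite /delta_max expR_le1 oppr_le0.
  by apply: addr_ge0; apply: mulr_ge0 => //; exact: ltW.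
have dE : expR (- (al * W ^+ 2)) = delta.
  by rewrite halfwidth_sqr// d0 (lt_le_trans dm).
have AW : 100 * al + 15 * error_constant < al * W ^+ 2.
  by move: dm; rewrite -dE ltr_expR ltrN2.
have W0 : 0 <= W by rewrite mulr_ge0 ?sqrtr_ge0// invr_ge0 pi_ge0.
split=> //; last by have := mulr_gt0 (ltr0n R 100) al_gt0; nra.
rewrite leNgt; apply/negP => W10.
have : W ^+ 2 <= 100 by nra.
rewrite -(ler_pM2l al_gt0) => h; lra.
Qed.

Variables (T : R) (N s : nat) (delta : R).
Hypotheses (T_gt1 : 1 < T) (N_gt0 : (0 < N)%N) (s_gt0 : (0 < s)%N)
  (delta_bnd : 0 < delta < delta_max).
Let W := halfwidth tau0 delta.
Let Phi : 'M[R]_(s * N, N) := Pimx R N s *m Ac T tau0 N s.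
Let Y := Phi *m invmx (Phi^T *m Phi) *m (Phi^T *m outer_part T tau0 N s).

Lemma outer_low_rank : exists M : 'M[R]_N,
  (\rank M)%:R <= 4 * W /\
  forall r, r \in colloc T N s -> \sum_j `|Y r j - (Y *m M) r j| <= delta.
Proof.
have [W10 dE KW] := delta_max_width delta_bnd.
rewrite -/W in W10 dE KW.
pose A := al * W ^+ 2; rewrite -/A in dE KW.
(* The sum 19/10 W leaves W/10 >= 1 for counting. The decay exponents become 9/10 (4/5)^2 = 0.576 >
   1/2 and 9/10 (11/10)^2 = 1.089 > 1. *)
pose t0 := 4 / 5 * W; pose r0 := 11 / 10 * W.
have t00 : 0 <= t0 by rewrite /t0; lra.
have r00 : 0 <= r0 by rewrite /r0; lra.
pose Fi := [set j : 'I_N | t0 <= depth T j]; pose Fo := [set j : 'I_N | depth T j <= - r0].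
have sR : 0 < s%:R :> R by rewrite ltr0n.
have w0 (j : 'I_N) : 0 <= weight T tau0 j.
  by rewrite mulr_ge0 ?expR_ge0// gbound_ge0// divr_gt0.
have FiFo : [disjoint Fi & Fo].
  apply/pred0P => j; rewrite !inE; apply/negP => /andP[h1 h2]; move: h1 h2.
  by rewrite /t0 /r0; lra.
have SFi : \sum_(j in Fi) weight T tau0 j <= G * expR (- (9 / 10 * al * t0 ^+ 2)).
  apply: sum_weight => // j; rewrite inE => tj.
  by rewrite ger0_norm//; lra.
have SFo : \sum_(j in Fo) weight T tau0 j <= G * expR (- (9 / 10 * al * r0 ^+ 2)).
  apply: sum_weight => // j; rewrite inE => tj.
  by rewrite ler0_norm//; lra.
have SFi0 : 0 <= \sum_(j in Fi) weight T tau0 j by exact: sumr_ge0.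
have SFo0 : 0 <= \sum_(j in Fo) weight T tau0 j by exact: sumr_ge0.
have A0 : 0 <= A by rewrite mulr_ge0 ?sqr_ge0// ltW.
(* The ridge parameter is mu = exp (- A). As 0.576 > 1/2, the squared weights over [Fi] sum to at
   most G^2 exp (- A), and (1 + G)^2 covers 1 + G^2. *)
pose th := (1 + G) * expR (- (A / 2)); pose nu := expR (A / 2).
have eE : expR (- (A / 2)) ^+ 2 = expR (- A).
  by rewrite expr2 -expRD; congr expR; field.
have thb : expR (- A) + \sum_(j in Fi) weight T tau0 j ^+ 2 <= th ^+ 2.
  have h : \sum_(j in Fi) weight T tau0 j ^+ 2 <= (G * expR (- (A / 2))) ^+ 2.
    apply: (@le_trans _ _ ((\sum_(j in Fi) weight T tau0 j) ^+ 2)).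
      rewrite big_mkcond [in leRHS]big_mkcond.
      have h0 (j : 'I_N) : 0 <= (if j \in Fi then weight T tau0 j else 0) by case: ifP.
      apply: le_trans (sum_sqr_le h0); apply: ler_sum => j _.
      by case: ifP => // _; rewrite sqr_ge0.
    rewrite ler_pXn2r ?nnegrE//; last by rewrite mulr_ge0 ?expR_ge0.
    apply: le_trans SFi _; rewrite ler_wpM2l// ler_expR lerN2.
    by rewrite /t0 /A; have := A0; rewrite /A; lra.
  apply: le_trans (lerD (lexx _) h) _; rewrite /th [leRHS]exprMn [X in _ + X <= _]exprMn eE.
  have := expR_ge0 (- A); move: (expR _) => e e0.
  have -> : (1 + G) ^+ 2 * e = e + G ^+ 2 * e + 2 * (G * e) by ring.
  by rewrite lerDl mulr_ge0// mulr_ge0.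
have nub : (expR (- A))^-1 <= nu ^+ 2.
  by rewrite expRN invrK /nu expr2 -expRD; have -> : A / 2 + A / 2 = A by field.
have Fi_col j : j \in Fi ->
    \sum_(r | r \notin colloc T N s) Phi r j ^+ 2 <= s%:R * weight T tau0 j ^+ 2.
  rewrite inE => jF; apply: Phi_col_weight => // r rO.
  by rewrite rO (le_trans t00 jF).
have Fo_depth j r : j \in Fo -> r \in colloc T N s ->
    (r \notin colloc T N s) && (0 <= depth T j) || (r \in colloc T N s) && (depth T j <= 0).
  by rewrite inE => jF ->; apply/orP; right; rewrite /= (le_trans jF)// oppr_le0.
have Fo_entry j r : j \in Fo -> r \in colloc T N s -> `|Phi r j| <= weight T tau0 j.
  move=> jF rO; rewrite ger0_norm ?Phi_ge0//.
  by apply: Phi_entry_weight => //; exact: Fo_depth.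
have Fo_col j : j \in Fo ->
    \sum_(r in colloc T N s) Phi r j ^+ 2 <= s%:R * weight T tau0 j ^+ 2.
  by move=> jF; apply: Phi_col_weight => // r rO; exact: Fo_depth.
have th0 : 0 <= th by rewrite mulr_ge0 ?expR_ge0// addr_ge0.
have [M [rM errM]] := low_rank_approx sR c_gt0 B_ge0 (expR_gt0 (- A)) th0
  (expR_ge0 _ : 0 <= nu) w0 w0 FiFo (Phi_riesz T_gt1 tau0_gt0 N_gt0 s_gt0)
  (Phi_row_bound T_gt1 tau0_gt0 N_gt0 s_gt0) Fi_col Fo_entry Fo_col thb nub.
exists M; split.
  have -> : 4 * W = 2 * (t0 + r0 + W / 10) by rewrite /t0 /r0; field.
  apply: (@le_trans _ _ (2 * (t0 + r0 + 1))); last by rewrite ler_pM2l// lerD2l; lra.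
  apply: le_trans (card_strip T N t00 r00); rewrite ler_nat.
  apply: leq_trans rM _; apply: subset_leq_card; apply/fintype.subsetP => j.
  by rewrite !inE negb_or -!ltNge andbC.
move=> r rO; apply: le_trans (errM r rO) _; rewrite -dE.
have SFiA : \sum_(j in Fi) weight T tau0 j <= G * expR (- (576 / 1000 * A)).
  apply: le_trans SFi _; rewrite ler_wpM2l// ler_expR lerN2 /t0 /A.
  by rewrite le_eqVlt; apply/orP; left; apply/eqP; field.
have SFoA : \sum_(j in Fo) weight T tau0 j <= G * expR (- (1089 / 1000 * A)).
  apply: le_trans SFo _; rewrite ler_wpM2l// ler_expR lerN2 /r0 /A.
  by rewrite le_eqVlt; apply/orP; left; apply/eqP; field.
(* The three error terms decay with exponents 0.576 + 1/2 = 1.076, 0.576 + 1.089 - 1/2 = 1.165 and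
   1.089, all at least 1.07. The excess exp (- 0.07 A) over delta absorbs [error_constant]. *)
pose e := expR (- (107 / 100 * A)).
have e0 : 0 <= e by exact: expR_ge0.
have expA (x y : R) : 107 / 100 * A <= x -> y = - x -> expR y <= e.
  by move=> xA ->; rewrite ler_expR lerN2.
have t1 : (\sum_(j in Fi) weight T tau0 j) * (B * th / c ^+ 2) <=
    G * (B * (1 + G) / c ^+ 2) * e.
  have -> : B * th / c ^+ 2 = B * (1 + G) / c ^+ 2 * expR (- (A / 2)).
    by rewrite /th; ring.
  apply: le_trans (_ : G * expR (- (576 / 1000 * A)) *
      (B * (1 + G) / c ^+ 2 * expR (- (A / 2))) <= _).
    by rewrite ler_wpM2r// mulr_ge0 ?expR_ge0.
  rewrite mulrACA -expRD; apply: ler_wpM2l; first exact: mulr_ge0.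
  by apply: (expA (1076 / 1000 * A)); [lra|field].
have t2 : (\sum_(j in Fi) weight T tau0 j) *
    ((\sum_(j in Fo) weight T tau0 j) * (1 + B / c) * nu) <= G * (G * (1 + B / c)) * e.
  apply: le_trans (_ : G * expR (- (576 / 1000 * A)) *
      (G * expR (- (1089 / 1000 * A)) * (1 + B / c) * nu) <= _).
    apply: ler_pM => //; first by rewrite !mulr_ge0 ?expR_ge0.
    by rewrite ler_wpM2r ?expR_ge0// ler_wpM2r.
  have -> : G * expR (- (576 / 1000 * A)) * (G * expR (- (1089 / 1000 * A)) * (1 + B / c) * nu)
      = G * (G * (1 + B / c)) * (expR (- (576 / 1000 * A)) * expR (- (1089 / 1000 * A)) * nu).
    by ring.
  rewrite -!expRD; apply: ler_wpM2l; first by apply: mulr_ge0 => //; exact: mulr_ge0.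
  by apply: (expA (1165 / 1000 * A)); [lra|field].
have t3 : (\sum_(j in Fo) weight T tau0 j) * (1 + B / c) <= G * (1 + B / c) * e.
  rewrite [leRHS]mulrAC ler_wpM2r//; apply: le_trans SFoA _; rewrite ler_wpM2l//.
  by apply: (expA (1089 / 1000 * A)); [lra|].
apply: (@le_trans _ _ (error_constant * e)).
  have -> : error_constant * e = G * (B * (1 + G) / c ^+ 2) * e
      + G * (G * (1 + B / c)) * e + G * (1 + B / c) * e.
    by rewrite /error_constant; ring.
  by rewrite mulrDr; apply: lerD => //; apply: lerD.
apply: (@le_trans _ _ (expR (7 / 100 * A) * e)).
  by rewrite ler_wpM2r//; apply: le_trans KW _; apply: le_trans (expR_ge1Dx _); rewrite lerDr.
rewrite -expRD ler_expR; lra.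
Qed.

End Constants.

Theorem theorem4p6 (R : realType) (tau0 : R) (htau0 : 0 < tau0) :
  exists2 delta0 : R, 0 < delta0 &
    forall (T : R) (N s : nat),
      1 < T -> (0 < N)%N -> (0 < s)%N -> (N < npts T N s)%N ->
      forall delta : R, 0 < delta < delta0 ->
        exists Q : 'M[R[i]]_(npts T N s, N),
          norm_inf Q <= 1 /\
          (\rank (AZres T tau0 N s + delta%:C *: Q)%R)%:R <= 4 * halfwidth tau0 delta.
Proof.
exists (delta_max tau0); first exact: expR_gt0.
move=> T N s T1 N0 s0 _ delta dd; have [d0 _] := andP dd.
have [M [rM errM]] := outer_low_rank htau0 T1 N0 s0 dd.
set Phi := Pimx R N s *m Ac T tau0 N s in errM.
set Y := Phi *m _ *m _ in errM.
have k0 : 0 < s%:R * (theta_low (alpha tau0) / 4) ^+ 2.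
  rewrite mulr_gt0 ?ltr0n// exprn_gt0// divr_gt0//.
  by rewrite /theta_low mulr_gt0 ?exprn_gt0 ?mulr_gt0 ?expR_gt0.
have uG := gram_unitmx k0 (Phi_riesz T1 htau0 N0 s0).
have ZE : AZres T tau0 N s = toC (restr T N s *m Y) by exact: AZresE.
(* Adding X replaces R Y by the low-rank R Y M. Dividing by delta gives Q, whose row sums are at
   most 1 by [errM]. *)
pose X := restr T N s *m (Y *m M) - restr T N s *m Y.
exists (toC (delta^-1 *: X)).
have rowE (A : 'M[R]_(s * N, N)) p j : (restr T N s *m A) p j = A (enum_val p) j.
  rewrite mxE (bigD1 (enum_val p))//= big1 ?addr0 => [|q /negPf qp].
    by rewrite mxE eqxx mul1r.
  by rewrite mxE qp mul0r.
split.
  rewrite /norm_inf; apply: bigmax_le => // p _.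
  have XE j : ComplexField.Normc.normc (toC (delta^-1 *: X) p j) =
      delta^-1 * `|Y (enum_val p) j - (Y *m M) (enum_val p) j|.
    have -> : toC (delta^-1 *: X) p j =
        (delta^-1 * ((Y *m M) (enum_val p) j - Y (enum_val p) j))%:C.
      have sub (A C : 'M[R]_(npts T N s, N)) : (A - C) p j = A p j - C p j by rewrite !mxE.
      have scal (a : R) (A : 'M[R]_(npts T N s, N)) : (a *: A) p j = a * A p j by rewrite mxE.
      have toCE (A : 'M[R]_(npts T N s, N)) : toC A p j = (A p j)%:C by rewrite mxE.
      by rewrite toCE scal /X sub !rowE.
    by rewrite normc_real normrM gtr0_norm ?invr_gt0// distrC.
  under eq_bigr do rewrite XE.
  rewrite -mulr_sumr ler_pdivrMl// mulr1; apply: errM; exact: enum_valP.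
have -> : AZres T tau0 N s + delta%:C *: toC (delta^-1 *: X) =
    toC (restr T N s *m (Y *m M)).
  have -> : delta%:C *: toC (delta^-1 *: X) = toC X.
    apply/matrixP => p j; rewrite !mxE -rmorphM/= mulrA divff ?gt_eqF//.
    by rewrite mul1r.
  have toCD (A C : 'M[R]_(npts T N s, N)) : toC A + toC C = toC (A + C).
    by rewrite /toC map_mxD.
  by rewrite ZE toCD /X addrC subrK.
rewrite /toC mxrank_map; apply: le_trans rM; rewrite ler_nat mulmxA.
exact: mxrankM_maxr.
Qed.
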